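(* Let $\mathcal N_{A\to B}$ be an arbitrary $s$-sender quantum multiple-access channel, where $A=\bigotimes_{k=1}^s A_k$. Then the entanglement-assisted classical capacity of the total communication rate is additive: $$C_{{\rm E},U}(\mathcal N)=C^{(1)}_{{\rm E},U}(\mathcal N).$$
   Context: A quantum multiple-access channel (MAC) with $s\ge 1$ senders is a completely positive trace-preserving map $\mathcal N_{A\to B}$ from the composite input system $A=\bigotimes_{k=1}^s A_k$ (sender $k$ controls $A_k$) to a single output system $B$ held by one receiver. In entanglement-assisted communication each sender $k$ shares with the receiver a reference system $A'_k$, and the joint input is a pure product state $\hat\phi_{AA'}=\bigotimes_{k=1}^s\hat\phi_{A_kA'_k}$ with $A'=\bigotimes_k A'_k$. For such $\hat\phi$ put $\hat\rho_{BA'}=(\mathcal N_{A\to B}\otimes\mathcal I_{A'})(\hat\phi_{AA'})$ and $\tilde C_{{\rm E},U}(\mathcal N,\hat\phi)=I(A';B)_{\hat\rho}$ (quantum mutual information, $U=\{1,\dots,s\}$). Define $C^{(1)}_{{\rm E},U}(\mathcal N)=\sup_{\hat\phi}\tilde C_{{\rm E},U}(\mathcal N,\hat\phi)$, the supremum over all pure states that are products across the senders, and $C_{{\rm E},U}(\mathcal N)=\lim_{n\to\infty}\frac1n C^{(1)}_{{\rm E},U}(\mathcal N^{\otimes n})$, where $\mathcal N^{\otimes n}$ is regarded as an $s$-sender MAC whose $k$th sender controls $A_k^{\otimes n}$ (so inputs may be entangled across the $n$ channel uses within each sender, but the state is still a product across senders). *)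

(* Defs.v *)
(* mathcomp-analysis (R : realType) + real-closed complex R[i]. *)
From HB Require Import structures.
From mathcomp Require Import all_boot all_order all_algebra.
From mathcomp Require Import all_classical all_reals all_analysis.
From mathcomp Require Import complex.
Set Implicit Arguments. Unset Strict Implicit. Unset Printing Implicit Defensive.
Import Order.TTheory GRing.Theory Num.Theory ComplexField.

Local Open Scope ring_scope.
Local Open Scope classical_set_scope.

Section QInfo.
Variable R : realType.
Local Notation C := (R[i]).

(* operators (matrices) on the Hilbert space C^I, I a finite index type *)
Definition Mat (I : finType) := I -> I -> C.

Definition trace (I : finType) (X : Mat I) : C := \sum_(i : I) X i i.

(* positive semidefinite (over C, this implies Hermitian) *)
Definition psd (I : finType) (X : Mat I) : Prop :=
  forall v : I -> C, 0 <= \sum_(i : I) \sum_(j : I) (v i)^* * X i j * v j.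

Definition unitary (I : finType) (U : Mat I) : Prop :=
  forall i j : I, \sum_(k : I) (U k i)^* * U k j = (i == j)%:R.

(* von Neumann entropy S(rho) = - sum_k lam_k ln lam_k, where the lam_k are the
   eigenvalues of rho, taken from any spectral decomposition
   rho = U diag(lam) U^*  (natural logarithm; ln 0 = 0 in mathcomp-analysis) *)
Definition entropy (I : finType) (rho : Mat I) : R :=
  xget 0 [set x : R | exists (U : Mat I) (lam : I -> R), unitary U /\
     (forall i j, rho i j = \sum_(k : I) U i k * ((lam k)%:C)%C * (U j k)^*) /\
     x = - \sum_(k : I) lam k * ln (lam k)].

Definition ptrace1 (I J : finType) (X : Mat (I * J)%type) : Mat J :=
  fun j j' => \sum_(i : I) X (i, j) (i, j').
Definition ptrace2 (I J : finType) (X : Mat (I * J)%type) : Mat I :=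
  fun i i' => \sum_(j : J) X (i, j) (i', j).

(* quantum mutual information I(X;Y) of a bipartite operator on X * Y *)
Definition qmutinf (I J : finType) (rho : Mat (I * J)%type) : R :=
  entropy (ptrace2 rho) + entropy (ptrace1 rho) - entropy rho.

(* (N (x) id_K) applied to an operator on A * K, output on B * K *)
Definition tensor_id (A B K : finType) (N : Mat A -> Mat B)
  (X : Mat (A * K)%type) : Mat (B * K)%type :=
  fun bk bk' => N (fun a a' => X (a, bk.2) (a', bk'.2)) bk.1 bk'.1.

Definition linear_map (A B : finType) (N : Mat A -> Mat B) : Prop :=
  forall (c : C) (X Y : Mat A),
    N (fun a a' => c * X a a' + Y a a') = (fun b b' => c * N X b b' + N Y b b').

Definition completely_positive (A B : finType) (N : Mat A -> Mat B) : Prop :=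
  forall (n : nat) (X : Mat (A * 'I_n)%type), psd X -> psd (tensor_id N X).

Definition trace_preserving (A B : finType) (N : Mat A -> Mat B) : Prop :=
  forall X : Mat A, trace (N X) = trace X.

Definition CPTP (A B : finType) (N : Mat A -> Mat B) : Prop :=
  [/\ linear_map N, completely_positive N & trace_preserving N].

(* s-sender MAC: sender k controls the system with index type Ain k;
   the composite input system A = (x)_k A_k has index type prodT Ain. *)
Definition prodT (s : nat) (T : 'I_s -> finType) : finType :=
  {dffun forall k : 'I_s, T k}.

(* the joint state of A A' for per-sender pure states psi_k on A_k A'_k:
   |psi> = (x)_k |psi_k>, phi = |psi><psi| *)
Definition prod_pure (s : nat) (Ain Aref : 'I_s -> finType)
  (psi : forall k : 'I_s, (Ain k * Aref k)%type -> C)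
  : Mat (prodT Ain * prodT Aref)%type :=
  let v := fun (xy : (prodT Ain * prodT Aref)%type) =>
             \prod_(k : 'I_s) psi k (xy.1 k, xy.2 k) in
  fun xy xy' => v xy * (v xy')^*.

Definition normalized (I : finType) (v : I -> C) : Prop :=
  \sum_(i : I) (v i)^* * v i = 1.

(* \tilde C_{E,U}(N, phi) = I(A';B)_rho with rho_{BA'} = (N (x) id_{A'})(phi) *)
Definition CtildeEU (s : nat) (Ain : 'I_s -> finType) (B : finType)
  (N : Mat (prodT Ain) -> Mat B) (Aref : 'I_s -> finType)
  (psi : forall k : 'I_s, (Ain k * Aref k)%type -> C) : R :=
  qmutinf (tensor_id N (prod_pure psi)).

(* C^{(1)}_{E,U}(N): supremum over all reference systems A'_k (of arbitrary
   finite dimension d_k) and all pure product states *)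
Definition C1EU (s : nat) (Ain : 'I_s -> finType) (B : finType)
  (N : Mat (prodT Ain) -> Mat B) : \bar R :=
  ereal_sup [set x : \bar R | exists (d : 'I_s -> nat)
      (psi : forall k : 'I_s, (Ain k * 'I_(d k))%type -> C),
      (forall k, normalized (psi k)) /\
      x = (CtildeEU N psi)%:E].

(* n channel uses *)
Definition powT (n : nat) (T : finType) : finType := {ffun 'I_n -> T}.

(* the unit matrix E_{x x'} *)
Definition matunit (I : finType) (x x' : I) : Mat I :=
  fun i j => ((i == x) && (j == x'))%:R.

(* N^{(x)n}, regarded as an s-sender MAC whose k-th sender controls A_k^{(x)n}:
   N^{(x)n}(X) = sum_{x,x'} X_{x x'} (x)_{i<n} N(E_{x_i x'_i}) *)
Definition tensor_pow (s : nat) (Ain : 'I_s -> finType) (B : finType)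
  (N : Mat (prodT Ain) -> Mat B) (n : nat) :
  Mat (prodT (fun k => powT n (Ain k))) -> Mat (powT n B) :=
  fun X b b' =>
    \sum_(x : prodT (fun k => powT n (Ain k)))
    \sum_(x' : prodT (fun k => powT n (Ain k)))
      X x x' * \prod_(i < n)
        N (matunit ([ffun k => x k i] : prodT Ain)
                   ([ffun k => x' k i] : prodT Ain)) (b i) (b' i).

End QInfo.
Arguments tensor_pow {R s Ain B} N n _ _ _.

(* Main.v *)
(* Let V be a Stinespring isometry of N with environment E.  Purity of the
   joint state gives S(A') = S(BE) and S(A'B) = S(E), so that
   I(A';B) = S(B) + S(BE) - S(E) depends only on the reduced input state
   T = (x)_k tau_k.  For n uses let T_i be the reduced input of the i-th use;
   it is again a product across senders.  Then S(B^n) <= sum_i S(B_i), and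
   sum_i S(E_i) - S(E^n) <= sum_i S(B_i E_i) - S(B^n E^n) because the relative
   entropy D(rho || (x)_i rho_i) decreases under partial trace; adding the two
   bounds the n-use information by the sum of the single-use ones.  Tensor
   powers of the input give the converse inequality.

   Monotonicity of D(rho || sigma) follows from a variational formula: along
   the segment (1-u) sigma + u rho, the derivative of D is governed by
   <rho, ((1-u) L_sigma + u R_rho)^-1 rho>, which is a supremum over Y of
   expressions linear in (rho, sigma) and therefore decreases when Y is
   restricted to the operators 1 (x) Y. *)
Require Import Defs.
From HB Require Import structures.
From mathcomp Require Import all_boot all_order all_algebra.
From mathcomp Require Import all_classical all_reals all_analysis.
From mathcomp Require Import complex.
From mathcomp Require Import ring lra.
Import Order.TTheory GRing.Theory Num.Theory.
Local Open Scope ring_scope.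
Local Open Scope classical_set_scope.
Set Implicit Arguments.
Unset Strict Implicit.
Unset Printing Implicit Defensive.

(** * Kronecker sums and matrices over finite index types *)

Lemma sum_deltal (S : pzSemiRingType) (I : finType) (i : I) (F : I -> S) :
  \sum_j (i == j)%:R * F j = F i.
Proof.
rewrite (bigD1 i) //= eqxx mul1r big1 ?addr0 // => j /negPf.
by rewrite eq_sym => ->; rewrite mul0r.
Qed.

Lemma sum_deltar (S : pzSemiRingType) (I : finType) (i : I) (F : I -> S) :
  \sum_j F j * (j == i)%:R = F i.
Proof.
rewrite (bigD1 i) //= eqxx mulr1 big1 ?addr0 // => j /negPf ->.
by rewrite mulr0.
Qed.

Section FiniteMatrices.
Variable R : realType.
Local Notation C := (R[i]).
Local Notation rc := (real_complex R).

Definition mm (I J K : finType) (A : I -> J -> C) (B : J -> K -> C) : I -> K -> C :=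
  fun i k => \sum_j A i j * B j k.
Definition ad (I J : finType) (A : I -> J -> C) : J -> I -> C :=
  fun j i => (A i j)^*.
Definition dg (I : finType) (d : I -> R) : I -> I -> C :=
  fun i j => (i == j)%:R * rc (d i).
Definition id_mat (I : finType) : I -> I -> C := fun i j => (i == j)%:R.

Lemma mmA (I J K L : finType) (A : I -> J -> C) (B : J -> K -> C) (D : K -> L -> C) :
  mm A (mm B D) = mm (mm A B) D.
Proof.
apply/funext => i; apply/funext => l; rewrite /mm.
under eq_bigr do rewrite mulr_sumr.
rewrite exchange_big; apply: eq_bigr => k _; rewrite mulr_suml.
by apply: eq_bigr => j _; rewrite mulrA.
Qed.

Lemma mm1l (I J : finType) (A : I -> J -> C) : mm (@id_mat I) A = A.
Proof. by apply/funext => i; apply/funext => j; rewrite /mm sum_deltal. Qed.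

Lemma mm1r (I J : finType) (A : I -> J -> C) : mm A (@id_mat J) = A.
Proof. by apply/funext => i; apply/funext => j; rewrite /mm sum_deltar. Qed.

Lemma mm_dgr (I J : finType) (A : I -> J -> C) d i j :
  mm A (dg d) i j = A i j * rc (d j).
Proof.
rewrite /mm /dg -[RHS](sum_deltar j (fun j => A i j * rc (d j))).
by apply: eq_bigr => k _; rewrite -!mulrA; congr (_ * _); rewrite mulrC.
Qed.

Lemma mm_dgl (I J : finType) (A : I -> J -> C) d i j :
  mm (dg d) A i j = rc (d i) * A i j.
Proof.
rewrite /mm /dg -[RHS](sum_deltal i (fun k => rc (d i) * A k j)).
by apply: eq_bigr => k _; rewrite mulrA.
Qed.

Lemma ad_mm (I J K : finType) (A : I -> J -> C) (B : J -> K -> C) :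
  ad (mm A B) = mm (ad B) (ad A).
Proof.
apply/funext => i; apply/funext => j; rewrite /mm /ad rmorph_sum /=.
by apply: eq_bigr => k _; rewrite rmorphM mulrC.
Qed.

Lemma adK (I J : finType) (A : I -> J -> C) : ad (ad A) = A.
Proof. by apply/funext => i; apply/funext => j; rewrite /ad conjCK. Qed.

Lemma conj_rc (x : R) : (rc x)^* = rc x.
Proof. by apply/CrealP/complex_realP; exists x. Qed.

Lemma ad_dg (I : finType) (d : I -> R) : ad (dg d) = dg d.
Proof.
apply/funext => i; apply/funext => j; rewrite /ad /dg rmorphM /= conj_rc rmorph_nat.
by rewrite eq_sym; case: eqP => [->|_]; rewrite ?mul0r.
Qed.

Lemma trace_mmC (I J : finType) (A : I -> J -> C) (B : J -> I -> C) :
  trace (mm A B) = trace (mm B A).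
Proof.
rewrite /trace /mm exchange_big; apply: eq_bigr => j _.
by apply: eq_bigr => i _; rewrite mulrC.
Qed.

Definition sqn (z : C) : R := complex.Re (z * z^*).

Lemma sqnE z : rc (sqn z) = z * z^*.
Proof. by rewrite /sqn RRe_real // -normCK realX // normr_real. Qed.

Lemma sqn_ge0 z : 0 <= sqn z.
Proof. by rewrite -lecR sqnE mul_conjC_ge0. Qed.

Lemma rcI : injective rc.
Proof. by move=> x y []. Qed.

Definition xlnx (I : finType) (d : I -> R) : R := \sum_k d k * ln (d k).

(* [W] is block diagonal for the partition of its rows and columns by equal
   [a]- and [b]-values. *)
Lemma xlnx_gram (J K : finType) (W : J -> K -> C) a b :
  mm W (ad W) = dg a -> mm (ad W) W = dg b -> xlnx a = xlnx b.
Proof.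
move=> Wa Wb.
(* Both sides are entries of [W (ad W) W], so [W j k] can be nonzero only if [a j = b k]. *)
have comm j k : W j k * rc (b k) = rc (a j) * W j k.
  by rewrite -mm_dgr -mm_dgl -Wb -Wa mmA.
have aE j : a j = \sum_k sqn (W j k).
  apply: rcI; rewrite rmorph_sum /=.
  move: (congr1 (fun f => f j j) Wa); rewrite /dg eqxx mul1r => <-.
  by apply: eq_bigr => k _; rewrite sqnE.
have bE k : b k = \sum_j sqn (W j k).
  apply: rcI; rewrite rmorph_sum /=.
  move: (congr1 (fun f => f k k) Wb); rewrite /dg eqxx mul1r => <-.
  by apply: eq_bigr => j _; rewrite sqnE mulrC.
rewrite /xlnx; under eq_bigr => j _ do rewrite {1}aE mulr_suml.
under [RHS]eq_bigr => k _ do rewrite {1}bE mulr_suml.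
rewrite exchange_big; apply: eq_bigr => k _; apply: eq_bigr => j _.
have [->|W0] := eqVneq (W j k) 0.
  by rewrite /sqn mul0r !mul0r.
suff -> : a j = b k by [].
by apply: rcI; apply: (mulIf W0); rewrite -comm mulrC.
Qed.

(** Eigenvalues carry their own index type [K], so that tuples of eigenvalue labels can index the
    spectrum of a tensor product. *)
Definition spec (I K : finType) (rho : Mat R I) (U : I -> K -> C) (lam : K -> R) :=
  [/\ mm (ad U) U = @id_mat K, mm U (ad U) = @id_mat I &
      rho = mm (mm U (dg lam)) (ad U)].

(** Bridge to ordinal-indexed matrices, for the spectral theorem and the fact that a one-sided
    inverse is two-sided. *)
Definition mx_of (I : finType) (A : Mat R I) : 'M[C]_#|I| :=
  \matrix_(i, j) A (enum_val i) (enum_val j).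

Lemma mx_ofM (I : finType) (A B : Mat R I) : mx_of (mm A B) = mx_of A *m mx_of B.
Proof.
apply/matrixP => i j; rewrite !mxE /mm (reindex (@enum_val I I)) /=.
  by apply: eq_bigr => k _; rewrite !mxE.
by exists enum_rank => x _; rewrite ?enum_valK ?enum_rankK.
Qed.

Lemma mx_of_inj (I : finType) : injective (@mx_of I).
Proof.
move=> A B /matrixP AB; apply/funext => i; apply/funext => j.
by have := AB (enum_rank i) (enum_rank j); rewrite !mxE !enum_rankK.
Qed.

Lemma mx_of1 (I : finType) : mx_of (@id_mat I) = 1%:M.
Proof.
apply/matrixP => i j; rewrite !mxE /id_mat.
by rewrite (inj_eq enum_val_inj).
Qed.

Lemma unitary_mm (I : finType) (U : Mat R I) : unitary U ->
  mm (ad U) U = @id_mat I /\ mm U (ad U) = @id_mat I.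
Proof.
move=> UU; have UU' : mm (ad U) U = @id_mat I.
  by apply/funext => i; apply/funext => j; rewrite /mm /ad UU.
split=> //; apply: mx_of_inj; rewrite mx_ofM mx_of1; apply: mulmx1C.
by rewrite -mx_ofM UU' mx_of1.
Qed.

Lemma specP (I K : finType) (U : I -> K -> C) lam i j :
  mm (mm U (dg lam)) (ad U) i j = \sum_k U i k * rc (lam k) * (U j k)^*.
Proof. by apply: eq_bigr => k _; rewrite mm_dgr. Qed.

(** Polarization: the form is real at every vector [e_i + c e_j], and the cases [c = 1] and [c = 'i]
    together give conjugate symmetry. *)
Lemma psd_herm (I : finType) (X : Mat R I) : psd X -> ad X = X.
Proof.
move=> Xp.
have q c i j : 0 <= (X i i + X i j * c) + c^* * (X j i + X j j * c).
  have := Xp (fun k => (k == i)%:R + (k == j)%:R * c).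
  congr (_ <= _).
  have suml (F : I -> C) : \sum_k F k * ((k == i)%:R + (k == j)%:R * c) =
      F i + F j * c.
    rewrite -(sum_deltar i F) -(sum_deltar j F) mulr_suml -big_split /=.
    by apply: eq_bigr => k _; rewrite mulrDr mulrA.
  under eq_bigr => k _.
    under eq_bigr => l _ do rewrite -mulrA.
    rewrite -mulr_sumr suml rmorphD rmorphM !rmorph_nat mulrDl mulrAC; over.
  rewrite big_split /=.
  rewrite -(sum_deltal i (fun k => X k i + X k j * c)).
  rewrite -(sum_deltal j (fun k => X k i + X k j * c)) mulr_sumr.
  congr (_ + _); apply: eq_bigr => k _; first by rewrite eq_sym.
  by rewrite [RHS]mulrC eq_sym mulrAC.
have d0 k : (X k k)^* = X k k.
  apply: conj_Creal; apply: ger0_real.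
  by have := q 0 k k; rewrite !rmorph0 !(mulr0, mul0r, addr0).
have q' c i j : (X i i + (X i j)^* * c^*) + c * ((X j i)^* + X j j * c^*) =
    (X i i + X i j * c) + c^* * (X j i + X j j * c).
  rewrite -[RHS](conj_Creal (ger0_real (q c i j))).
  by rewrite !rmorphD /= !rmorphM /= !rmorphD /= !rmorphM /= conjCK !d0.
apply/funext => i; apply/funext => j; rewrite /ad.
have := q' 1 j i; have := q' 'i j i.
rewrite !conjCi !rmorph1.
set xx := X i i; set yy := X j j; set a := X j i; set b := X i j => h1 h2.
have i0 : 'i != 0 :> C by exact: neq0Ci.
have h4 : b^* - a^* = a - b.
  apply: (mulfI i0); apply: (addIr (yy - xx * ('i * 'i))).
  transitivity (yy + a^* * - 'i + 'i * (b^* + xx * - 'i)); first by ring.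
  by rewrite h1; ring.
have h5 : a^* + b^* = a + b.
  apply: (addIr (yy + xx)).
  transitivity (yy + a^* * 1 + 1 * (b^* + xx * 1)); first by ring.
  by rewrite h2; ring.
have h6 : 2%:R * a^* = 2%:R * b.
  transitivity ((a^* + b^*) - (b^* - a^*)); first by ring.
  by rewrite h4 h5; ring.
by apply: (mulfI _ h6); rewrite pnatr_eq0.
Qed.

End FiniteMatrices.

(** * Spectral decomposition and von Neumann entropy *)

Section Entropy.
Variable R : realType.
Local Notation C := (R[i]).
Local Notation rc := (real_complex R).

Lemma mx_of_ad (I : finType) (A : Mat R I) : mx_of (ad A) = map_mx Num.conj (mx_of A)^T.
Proof. by apply/matrixP => i j; rewrite !mxE. Qed.

Lemma mx_of_surj (I : finType) (M : 'M[C]_#|I|) :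
  exists A : Mat R I, mx_of A = M.
Proof.
exists (fun i j => M (enum_rank i) (enum_rank j)).
by apply/matrixP => i j; rewrite !mxE !enum_valK.
Qed.

Lemma psd_spec (I : finType) (X : Mat R I) : psd X ->
  exists (U : Mat R I) (lam : I -> R), spec X U lam /\ forall k, 0 <= lam k.
Proof.
move=> Xp; have Xh := psd_herm Xp.
have /orthomx_spectralP : mx_of X \is normalmx.
  by apply/normalmxP; rewrite -mx_of_ad Xh.
set P := spectralmx _; set D := spectral_diag _ => XE.
have PU : P \is unitarymx by exact: spectral_unitarymx.
have [U UE] := mx_of_surj (map_mx Num.conj P^T).
have adUE : mx_of (ad U) = P by rewrite mx_of_ad UE trmxCK.
have U1 : mm U (ad U) = @id_mat _ I.
  apply: (@mx_of_inj R I); rewrite mx_ofM UE adUE mx_of1 -invmx_unitary //.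
  by rewrite mulVmx // unitarymx_unit.
have U2 : mm (ad U) U = @id_mat _ I.
  apply: (@mx_of_inj R I); rewrite mx_ofM UE adUE mx_of1 -invmx_unitary //.
  by rewrite mulmxV // unitarymx_unit.
pose d k := D 0 (enum_rank k).
pose Dm : Mat R I := fun i j => (i == j)%:R * d i.
have DmE : mx_of Dm = diag_mx D.
  apply/matrixP => i j; rewrite !mxE /Dm /d enum_valK (inj_eq enum_val_inj).
  by rewrite mulr_natl.
have XE' : X = mm (mm U Dm) (ad U).
  by apply: (@mx_of_inj R I); rewrite !mx_ofM UE adUE DmE XE invmx_unitary.
have DE : Dm = mm (mm (ad U) X) U.
  by rewrite XE' !mmA U2 mm1l -mmA U2 mm1r.
(* [d k] is the quadratic form of [X] at the [k]-th column of [U]. *)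
have d_ge0 k : 0 <= d k.
  have := congr1 (fun f => f k k) DE; rewrite /Dm eqxx mul1r => ->.
  have := Xp (fun i => U i k); congr (_ <= _); rewrite /mm exchange_big /=.
  by apply: eq_bigr => i _; rewrite mulr_suml.
exists U, (fun k => complex.Re (d k)); split; last first.
  by move=> k; rewrite -lecR RRe_real // ger0_real.
split=> //; rewrite XE'; congr (mm (mm U _) _).
apply/funext => i; apply/funext => j; rewrite /Dm /dg.
by rewrite RRe_real // ger0_real.
Qed.

Lemma psd_mm_ad (I K : finType) (G : I -> K -> C) : psd (mm G (ad G)).
Proof.
move=> v.
have -> : \sum_i \sum_j (v i)^* * mm G (ad G) i j * v j =
    \sum_k (\sum_i (v i)^* * G i k) * (\sum_i (v i)^* * G i k)^*.
  under eq_bigr => i _.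
    under eq_bigr => j _ do rewrite /mm mulr_sumr mulr_suml.
    rewrite exchange_big; over.
  rewrite exchange_big /=; apply: eq_bigr => k _.
  rewrite mulr_suml; apply: eq_bigr => i _.
  rewrite rmorph_sum mulr_sumr; apply: eq_bigr => j _.
  by rewrite rmorphM /= conjCK /ad; ring.
by apply: sumr_ge0 => k _; rewrite mul_conjC_ge0.
Qed.

Lemma psd_gram (I : finType) (X : Mat R I) : psd X ->
  exists G : Mat R I, X = mm G (ad G).
Proof.
move=> /psd_spec[U [lam [[_ _ XE] lam_ge0]]].
exists (mm U (dg (fun k => Num.sqrt (lam k)))).
rewrite ad_mm ad_dg !mmA -[mm (mm U _) (dg _)]mmA XE; congr (mm (mm U _) _).
apply/funext => i; apply/funext => j; rewrite mm_dgr /dg.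
case: eqP => [->|_]; rewrite ?mul0r // !mul1r -rmorphM /=.
by rewrite -expr2 sqr_sqrtr.
Qed.

(** [mm G (ad G)] and [mm (ad G) G] share their nonzero eigenvalues, and zeros contribute nothing to
    [xlnx]. As this compares [d] with every spectral decomposition of [rho], the value picked in
    [entropy] does not depend on the choice. *)
Lemma entropy_gram (I K : finType) (rho : Mat R I) (G : I -> K -> C) d :
  rho = mm G (ad G) -> mm (ad G) G = dg d -> entropy rho = - xlnx d.
Proof.
move=> rhoE GG.
have uniq (U : Mat R I) lam : spec rho U lam -> xlnx lam = xlnx d.
  move=> [UU1 UU2 rhoE']; apply: (xlnx_gram (W := mm (ad U) G)).
    rewrite ad_mm adK mmA -(mmA _ G) -rhoE rhoE' !mmA UU1 mm1l -mmA UU1 mm1r //.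
  by rewrite ad_mm adK mmA -(mmA _ U) UU2 mm1r.
rewrite /entropy; case: xgetP => [x _ /=|].
  move=> [U [lam [/unitary_mm[U1 U2] [rhoE' ->]]]].
  rewrite -(uniq U lam) //; split=> //.
  apply/funext => i; apply/funext => j; rewrite specP; exact: rhoE'.
(* The default value of [xget] is never reached: a spectral decomposition exists. *)
have [U [lam [sp _]]] := psd_spec (@psd_mm_ad _ _ G).
rewrite -rhoE in sp.
move=> /(_ (- xlnx lam)) /= []; exists U, lam; case: sp => U1 U2 rhoE'.
split; first by move=> i j; have := congr1 (fun f => f i j) U1.
by split=> // i j; rewrite {1}rhoE' specP.
Qed.

Lemma spec_psd (I K : finType) (rho : Mat R I) (U : I -> K -> C) lam :
  spec rho U lam -> (forall k, 0 <= lam k) ->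
  exists G : I -> K -> C, rho = mm G (ad G) /\ mm (ad G) G = dg lam.
Proof.
move=> [U1 U2 rhoE] lam_ge0.
have sq : mm (dg (fun k => Num.sqrt (lam k))) (dg (fun k => Num.sqrt (lam k)))
    = dg lam.
  apply/funext => i; apply/funext => j; rewrite mm_dgr /dg.
  case: eqP => [->|_]; rewrite ?mul0r // !mul1r -rmorphM /=.
  by rewrite -expr2 sqr_sqrtr.
exists (mm U (dg (fun k => Num.sqrt (lam k)))); rewrite ad_mm ad_dg; split.
  by rewrite !mmA -[mm (mm U _) (dg _)]mmA sq.
by rewrite !mmA -[mm (mm _ (ad U)) U]mmA U1 mm1r sq.
Qed.

Lemma entropy_spec (I K : finType) (rho : Mat R I) (U : I -> K -> C) lam :
  spec rho U lam -> (forall k, 0 <= lam k) -> entropy rho = - xlnx lam.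
Proof. by move=> sp /(spec_psd sp)[G [h1 h2]]; apply: entropy_gram h1 h2. Qed.

(** Schmidt decomposition: the two operators are the marginals of the vector with amplitudes
    [G i j], and have the same nonzero spectrum. *)
Lemma entropy_dual (I J : finType) (G : I -> J -> C) :
  entropy (mm G (ad G)) =
  entropy ((fun j j' => \sum_i G i j * (G i j')^*) : Mat R J).
Proof.
set rho2 : Mat R J := (fun _ _ => _).
pose G' : J -> I -> C := fun j i => G i j.
have rho2E : rho2 = mm G' (ad G') by [].
have [U [lam [sp lam_ge0]]] := psd_spec (psd_mm_ad G').
rewrite rho2E (entropy_spec sp lam_ge0); case: sp => U1 U2 rho2E'.
(* [mm (ad G) G] is the transpose of [rho2], so the complex conjugate of [U] diagonalizes it. *)
pose V : J -> J -> C := fun j k => (U j k)^*.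
have VV : mm V (ad V) = @id_mat _ J.
  apply/funext => i; apply/funext => j.
  have := congr1 (fun f : Mat R J => (f i j)^*) U2.
  rewrite /id_mat rmorph_nat => <-; rewrite /mm rmorph_sum.
  by apply: eq_bigr => k _; rewrite /ad /V rmorphM.
apply: (@entropy_gram _ _ _ (mm G V)).
  by rewrite ad_mm mmA -(mmA _ V) VV mm1r.
have DE : mm (mm (ad U) (mm G' (ad G'))) U = dg lam.
  by rewrite rho2E' !mmA U1 mm1l -mmA U1 mm1r.
apply/funext => k; apply/funext => k'.
rewrite -[RHS](_ : dg lam k' k = _); last first.
  by rewrite -{1}(ad_dg lam) /ad /dg rmorphM /= conj_rc rmorph_nat.
have gramT j j' : mm (ad G) G j j' = mm G' (ad G') j' j.
  by apply: eq_bigr => i _; rewrite /ad /G' mulrC.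
rewrite -DE ad_mm -mmA (mmA (ad G)) [LHS]/mm [RHS]/mm.
apply: eq_bigr => j _; rewrite /ad {1}/V conjCK mulrC; congr (_ * _).
by apply: eq_bigr => j' _; rewrite gramT mulrC.
Qed.

End Entropy.

(** * A logarithmic inequality by interpolation *)

Section ScalarInequality.
Variable R : realType.

Lemma is_derive_bigsum (X : finType) (f : X -> R -> R) (df : X -> R) (u : R) :
  (forall x, is_derive u 1 (f x) (df x)) ->
  is_derive u 1 (fun t => \sum_x f x t) (\sum_x df x).
Proof.
move=> fd; rewrite -[fun t => _]/(fun t => \sum_x f x t).
have -> : (fun t => \sum_x f x t) = \sum_x f x.
  by apply/funext => t; rewrite fct_sumE.
elim/big_rec2: _ => [|x a g _ gd]; first exact: is_derive_cst.
exact: is_deriveD.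
Qed.

Lemma convex_gt0 (s r u : R) : 0 < s -> 0 < r -> 0 <= u <= 1 ->
  0 < (1 - u) * s + u * r.
Proof.
move=> s0 r0 /andP[u0 u1]; have [->|un1] := eqVneq u 1; first by lra.
apply: ltr_wpDr; first by rewrite mulr_ge0 // ltW.
by rewrite mulr_gt0 // subr_gt0 lt_neqAle un1.
Qed.

(** Positivity is required only where [c] is nonzero, since otherwise the function is constant; this
    admits states without full rank. *)
Lemma is_derive_ln_segment (c s r u : R) :
  (c != 0 -> 0 < s /\ 0 < r) -> 0 <= u <= 1 ->
  is_derive u 1 (fun t => c * ln ((1 - t) * s + t * r))
    (c * ((r - s) / ((1 - u) * s + u * r))).
Proof.
move=> pos u01; have [->|/pos[s0 r0]] := eqVneq c 0.
  rewrite mul0r (_ : (fun t => _) = cst 0); first exact: is_derive_cst.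
  by apply/funext => t; rewrite mul0r.
have w0 := convex_gt0 s0 r0 u01.
have dw : is_derive u 1 (fun t : R => (1 - t) * s + t * r) (r - s).
  apply: is_derive_eq; rewrite /GRing.scale /=; ring.
have dl := is_derive1_ln w0.
have dc := @is_derive1_comp R (@ln R) (fun t : R => (1 - t) * s + t * r) u _ _ dl dw.
have := is_deriveZ c dc; rewrite /GRing.scale /= => h.
by apply: is_derive_eq; rewrite /GRing.scale /=; ring.
Qed.

(** The difference of the weighted logarithms, taken at [(1 - u) s + u r] and [(1 - u) s' + u r'],
    has a nonnegative derivative for [0 < u < 1]; the mean value theorem compares its values at 0
    and 1. *)
Lemma ln_interpolation (X Y : finType) (c s r : X -> R) (c' s' r' : Y -> R) :
  (forall x, c x != 0 -> 0 < s x /\ 0 < r x) ->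
  (forall y, c' y != 0 -> 0 < s' y /\ 0 < r' y) ->
  \sum_x c x = \sum_y c' y ->
  (forall u : R, 0 < u < 1 ->
    \sum_y c' y * (r' y / ((1 - u) * s' y + u * r' y)) <=
    \sum_x c x * (r x / ((1 - u) * s x + u * r x))) ->
  \sum_x c x * ln (s x) - \sum_y c' y * ln (s' y) <=
  \sum_x c x * ln (r x) - \sum_y c' y * ln (r' y).
Proof.
move=> pos pos' cc' le.
pose g (u : R) := \sum_x c x * ln ((1 - u) * s x + u * r x) -
  \sum_y c' y * ln ((1 - u) * s' y + u * r' y).
pose dg (u : R) := \sum_x c x * ((r x - s x) / ((1 - u) * s x + u * r x)) -
  \sum_y c' y * ((r' y - s' y) / ((1 - u) * s' y + u * r' y)).
have gd (u : R) : 0 <= u <= 1 -> is_derive u 1 g (dg u).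
  move=> u01; apply: is_deriveB; apply: is_derive_bigsum => z;
    by apply: is_derive_ln_segment; auto.
have -> : \sum_x c x * ln (s x) - \sum_y c' y * ln (s' y) = g 0.
  by congr (_ - _); apply: eq_bigr => z _; congr (_ * ln _); ring.
have -> : \sum_x c x * ln (r x) - \sum_y c' y * ln (r' y) = g 1.
  by congr (_ - _); apply: eq_bigr => z _; congr (_ * ln _); ring.
have [||u] := @MVT _ g dg 0 1 ltr01.
- move=> x; rewrite in_itv /= => /andP[x0 x1]; apply: gd.
  by rewrite !ltW.
- apply: derivable_within_continuous => x; rewrite in_itv /= => x01.
  by have [] := gd _ x01.
rewrite in_itv /= subr0 mulr1 => u01 ge; rewrite -subr_ge0 ge.
have /andP[u0 u1] := u01; have v0 : 0 < 1 - u by rewrite subr_gt0.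
(* Since [(1 - u) (b - a) / w = b / w - 1] for [w = (1 - u) a + u b], the scaled derivative differs
   from the hypothesis only by the total weights, which are equal and cancel. *)
have ratio (Z : finType) (d a b : Z -> R) :
    (forall z, d z != 0 -> 0 < a z /\ 0 < b z) ->
    (1 - u) * \sum_z d z * ((b z - a z) / ((1 - u) * a z + u * b z)) =
    \sum_z d z * (b z / ((1 - u) * a z + u * b z)) - \sum_z d z.
  move=> dpos; rewrite mulr_sumr -sumrB; apply: eq_bigr => z _.
  have [->|/dpos[a0 b0]] := eqVneq (d z) 0; first by rewrite !mul0r mulr0 subr0.
  have w0 : 0 < (1 - u) * a z + u * b z by rewrite convex_gt0 // !ltW.
  by field; rewrite gt_eqF.
rewrite -(pmulr_rge0 _ v0) mulrBr !ratio // cc' opprB addrA subrK subr_ge0.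
exact: le.
Qed.

End ScalarInequality.

(** * Relative entropy and its variational formula *)

Section RelativeEntropy.
Variable R : realType.
Local Notation C := (R[i]).
Local Notation rc := (real_complex R).

(** The diagonal of [rho] in the basis of the columns of [S]. If [S] is an eigenbasis of sigma with
    eigenvalues [s], then Tr(rho ln sigma) is [\sum_l dgl S rho l * ln (s l)]. *)
Definition dgl (I L : finType) (S : I -> L -> C) (rho : Mat R I) (l : L) : R :=
  complex.Re (mm (mm (ad S) rho) S l l).

Lemma ReD (x y : C) : complex.Re (x + y) = complex.Re x + complex.Re y.
Proof. by case: x; case: y. Qed.

Lemma Re_sum (X : finType) (P : pred X) (F : X -> C) :
  complex.Re (\sum_(x | P x) F x) = \sum_(x | P x) complex.Re (F x).
Proof. exact: (big_morph _ ReD). Qed.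

Lemma Re_rcl (a : R) (x : C) : complex.Re (rc a * x) = a * complex.Re x.
Proof. by case: x => x y /=; rewrite mul0r subr0. Qed.

Lemma Re_rcr (a : R) (x : C) : complex.Re (x * rc a) = complex.Re x * a.
Proof. by rewrite mulrC Re_rcl mulrC. Qed.

Lemma sqnP (z : C) : sqn z = complex.Re z ^+ 2 + complex.Im z ^+ 2.
Proof. by apply: rcI; rewrite sqnE add_Re2_Im2 normCK. Qed.

Lemma Re_conjM (z m : C) : complex.Re (z^* * m) =
  complex.Re z * complex.Re m + complex.Im z * complex.Im m.
Proof.
rewrite (_ : z^* = (complex.Re z -i* complex.Im z)%C); last by case: z.
by case: m => a b /=; rewrite mulNr opprK.
Qed.

(** Completing the square; the maximizer is [z = m r / w], where [quad_eq] attains the bound. The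
    case [r = 0] is separate because [w] may then vanish. *)
Lemma quad_le (w r : R) (z m : C) : 0 <= w -> 0 <= r -> (r != 0 -> 0 < w) ->
  2 * complex.Re (z^* * m) * r - w * sqn z <= sqn m * r * (r / w).
Proof.
move=> w0 r0 rw; rewrite Re_conjM !sqnP.
case: z m => [a b] [x y] /=; have [->|/rw w1] := eqVneq r 0.
  rewrite !(mulr0, mul0r) sub0r oppr_le0.
  by rewrite mulr_ge0 // addr_ge0 // sqr_ge0.
rewrite -subr_ge0.
have -> : (x ^+ 2 + y ^+ 2) * r * (r / w) -
    (2 * (a * x + b * y) * r - w * (a ^+ 2 + b ^+ 2)) =
    w * ((a - x * (r / w)) ^+ 2 + (b - y * (r / w)) ^+ 2).
  by field; rewrite gt_eqF.
by rewrite mulr_ge0 // addr_ge0 // sqr_ge0.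
Qed.

Lemma quad_eq (w r : R) (m : C) : 0 <= r -> (r != 0 -> 0 < w) ->
  2 * complex.Re ((m * rc (r / w))^* * m) * r - w * sqn (m * rc (r / w)) =
  sqn m * r * (r / w).
Proof.
move=> r0 rw; rewrite Re_conjM !sqnP; case: m => x y /=.
rewrite !(mulr0, mul0r, addr0, subr0, add0r).
have [->|/rw w1] := eqVneq r 0; first by rewrite !(mulr0, mul0r, expr0n, addr0, subr0).
by field; rewrite gt_eqF.
Qed.

(* The supremum over [Y] is [<rho, ((1 - u) L_sigma + u R_rho)^-1 rho>] for the
   left and right multiplications [L_sigma] and [R_rho]; as [Y] enters through
   functionals linear in [(rho, sigma)], restricting it to [1 (x) Y] shows that
   the supremum decreases under partial trace. *)
Definition phi (I : finType) (u : R) (rho sigma Y : Mat R I) : R :=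
  2 * complex.Re (trace (mm rho (ad Y)))
  - ((1 - u) * complex.Re (trace (mm sigma (mm Y (ad Y))))
     + u * complex.Re (trace (mm rho (mm (ad Y) Y)))).

Section Diagonalized.
Variables (I K L : finType) (rho sigma : Mat R I).
Variables (U : I -> K -> C) (r : K -> R) (S : I -> L -> C) (s : L -> R).
Hypotheses (spr : spec rho U r) (sps : spec sigma S s).
Hypotheses (r_ge0 : forall k, 0 <= r k) (s_ge0 : forall l, 0 <= s l).

Definition overlap (l : L) (k : K) : C := mm (ad S) U l k.
(** Nussbaum-Szkola weights: their marginals are the spectrum of [rho] and the diagonal of [rho] in
    the eigenbasis of [sigma], so Tr(rho ln rho) and Tr(rho ln sigma) become sums against one joint
    weight. *)
Definition weight (lk : L * K) : R := sqn (overlap lk.1 lk.2) * r lk.2.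

Lemma overlapl l : \sum_k sqn (overlap l k) = 1.
Proof.
have [U1 U2 _] := spr; have [S1 S2 _] := sps.
have MM : mm (mm (ad S) U) (ad (mm (ad S) U)) = @id_mat _ L.
  by rewrite ad_mm adK mmA -(mmA _ U) U2 mm1r S1.
apply: rcI; rewrite rmorph_sum rmorph1 /=.
transitivity (mm (mm (ad S) U) (ad (mm (ad S) U)) l l).
2: by rewrite MM /id_mat eqxx.
by apply: eq_bigr => k _; rewrite /= sqnE.
Qed.

Lemma overlapr k : \sum_l sqn (overlap l k) = 1.
Proof.
have [U1 U2 _] := spr; have [S1 S2 _] := sps.
have MM : mm (ad (mm (ad S) U)) (mm (ad S) U) = @id_mat _ K.
  by rewrite ad_mm adK mmA -(mmA _ S) S2 mm1r U1.
apply: rcI; rewrite rmorph_sum rmorph1 /=.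
transitivity (mm (ad (mm (ad S) U)) (mm (ad S) U) k k).
2: by rewrite MM /id_mat eqxx.
by apply: eq_bigr => l _; rewrite /= sqnE mulrC.
Qed.

Lemma weight_ge0 lk : 0 <= weight lk.
Proof. by rewrite mulr_ge0 // sqn_ge0. Qed.

Lemma sum_weightr (f : K -> R) :
  \sum_lk weight lk * f lk.2 = \sum_k r k * f k.
Proof.
rewrite -(pair_bigA _ (fun l k => sqn (overlap l k) * r k * f k)) /=.
rewrite exchange_big /=; apply: eq_bigr => k _.
under eq_bigr do rewrite -mulrA.
by rewrite -mulr_suml overlapr mul1r.
Qed.

Lemma dgl_weight l : dgl S rho l = \sum_k weight (l, k).
Proof.
have [U1 U2 rhoE] := spr.
have -> : dgl S rho l =
    complex.Re (mm (mm (mm (ad S) U) (dg r)) (ad (mm (ad S) U)) l l).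
  by rewrite /dgl rhoE ad_mm adK !mmA.
rewrite specP Re_sum; apply: eq_bigr => k _; rewrite mulrAC Re_rcr.
by rewrite /weight /sqn /overlap.
Qed.

Lemma sum_weightl (f : L -> R) :
  \sum_lk weight lk * f lk.1 = \sum_l dgl S rho l * f l.
Proof.
rewrite -(pair_bigA _ (fun l k => weight (l, k) * f l)) /=.
by apply: eq_bigr => l _; rewrite dgl_weight mulr_suml.
Qed.

Lemma dgl_ge0 l : 0 <= dgl S rho l.
Proof. by rewrite dgl_weight sumr_ge0 // => k _; exact: weight_ge0. Qed.

Lemma sum_eigenvalues : \sum_k r k = complex.Re (trace rho).
Proof.
have [U1 U2 rhoE] := spr.
rewrite rhoE trace_mmC mmA U1 mm1l /trace Re_sum; apply: eq_bigr => k _.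
by rewrite /dg eqxx mul1r.
Qed.

(** The hypothesis says that the kernel of [sigma] lies in that of [rho]; it keeps the weights away
    from zero eigenvalues. *)
Lemma weight_pos : (forall l, s l = 0 -> dgl S rho l = 0) ->
  forall lk, weight lk != 0 -> 0 < s lk.1 /\ 0 < r lk.2.
Proof.
move=> supp [l k] wn0 /=; split; last first.
  rewrite lt_neqAle r_ge0 andbT; apply: contraNneq wn0 => r0.
  by rewrite /weight /= -r0 mulr0.
rewrite lt_neqAle s_ge0 andbT; apply: contraNneq wn0 => /esym/supp.
rewrite dgl_weight => /eqP; rewrite psumr_eq0; last first.
  by move=> k' _; exact: weight_ge0.
by move=> /allP/(_ k); rewrite mem_index_enum => /(_ isT).
Qed.

(** In the two eigenbases [(1 - u) L_sigma + u R_rho] is diagonal with entries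
    [(1 - u) s_l + u r_k], so [phi] splits into independent scalar quadratics in the entries of
    [Z]. *)
Lemma phi_expand u (Z : L -> K -> C) :
  phi u rho sigma (mm (mm S Z) (ad U)) =
  \sum_lk (2 * complex.Re ((Z lk.1 lk.2)^* * overlap lk.1 lk.2) * r lk.2
    - ((1 - u) * s lk.1 + u * r lk.2) * sqn (Z lk.1 lk.2)).
Proof.
have [U1 U2 rhoE] := spr; have [S1 S2 sigmaE] := sps.
set Y := mm (mm S Z) (ad U).
have adY : ad Y = mm (mm U (ad Z)) (ad S) by rewrite /Y !ad_mm adK mmA.
have t1 : trace (mm rho (ad Y)) =
    \sum_lk (Z lk.1 lk.2)^* * overlap lk.1 lk.2 * rc (r lk.2).
  have -> : trace (mm rho (ad Y)) = trace (mm (mm (mm (ad Z) (ad S)) U) (dg r)).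
    rewrite rhoE adY -!mmA trace_mmC !mmA -(mmA _ (ad U)) U1 mm1r.
    by rewrite -!mmA trace_mmC !mmA.
  rewrite -(pair_bigA _ (fun l k => (Z l k)^* * overlap l k * rc (r k))) /=.
  rewrite exchange_big /=; apply: eq_bigr => k _.
  by rewrite mm_dgr -mmA mulr_suml.
have t2 : trace (mm sigma (mm Y (ad Y))) =
    \sum_lk rc (s lk.1) * rc (sqn (Z lk.1 lk.2)).
  have -> : trace (mm sigma (mm Y (ad Y))) = trace (mm (dg s) (mm Z (ad Z))).
    rewrite sigmaE adY /Y !mmA -(mmA _ (ad U) U) U1 mm1r.
    rewrite trace_mmC !mmA S1 mm1l -(mmA _ (ad S) S) S1 mm1r.
    by rewrite -!mmA.
  rewrite -(pair_bigA _ (fun l k => rc (s l) * rc (sqn (Z l k)))) /=.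
  apply: eq_bigr => l _; rewrite mm_dgl -mulr_sumr; congr (_ * _).
  by apply: eq_bigr => k _; rewrite sqnE.
have t3 : trace (mm rho (mm (ad Y) Y)) =
    \sum_lk rc (r lk.2) * rc (sqn (Z lk.1 lk.2)).
  have -> : trace (mm rho (mm (ad Y) Y)) = trace (mm (dg r) (mm (ad Z) Z)).
    rewrite rhoE adY /Y !mmA -(mmA _ (ad S) S) S1 mm1r.
    rewrite trace_mmC !mmA U1 mm1l -(mmA _ (ad U) U) U1 mm1r.
    by rewrite -!mmA.
  rewrite -(pair_bigA _ (fun l k => rc (r k) * rc (sqn (Z l k)))) /=.
  rewrite exchange_big; apply: eq_bigr => k _; rewrite mm_dgl -mulr_sumr.
  by congr (_ * _); apply: eq_bigr => l _; rewrite sqnE mulrC.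
rewrite /phi t1 t2 t3 !Re_sum !mulr_sumr -big_split -sumrB /=.
by apply: eq_bigr => lk _; rewrite !Re_rcr /=; ring.
Qed.

(** The supremum of [phi] over [Y], that is, the quadratic form of the inverse superoperator at
    [rho], written in the eigenbases. *)
Definition resolvent (u : R) : R :=
  \sum_lk weight lk * (r lk.2 / ((1 - u) * s lk.1 + u * r lk.2)).

Lemma mix_pos (u : R) lk : 0 < u < 1 -> r lk.2 != 0 ->
  0 < (1 - u) * s lk.1 + u * r lk.2.
Proof.
move=> /andP[u0 u1] rn0; apply: ltr_wpDl.
  by rewrite mulr_ge0 // subr_ge0 ltW.
by rewrite mulr_gt0 // lt_neqAle eq_sym rn0 r_ge0.
Qed.

Lemma mix_ge0 (u : R) lk : 0 < u < 1 -> 0 <= (1 - u) * s lk.1 + u * r lk.2.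
Proof.
move=> /andP[u0 u1]; rewrite addr_ge0 // mulr_ge0 //; last exact: ltW.
by rewrite subr_ge0 ltW.
Qed.

Lemma phi_le (u : R) Y : 0 < u < 1 -> phi u rho sigma Y <= resolvent u.
Proof.
move=> u01; have [U1 U2 _] := spr; have [S1 S2 _] := sps.
have -> : Y = mm (mm S (mm (mm (ad S) Y) U)) (ad U).
  by rewrite !mmA S2 mm1l -mmA U2 mm1r.
rewrite phi_expand; apply: ler_sum => lk _; apply: quad_le => //.
  exact: mix_ge0.
exact: mix_pos.
Qed.

Lemma phi_max (u : R) : 0 < u < 1 -> exists Y, phi u rho sigma Y = resolvent u.
Proof.
move=> u01; pose Z l k := overlap l k * rc (r k / ((1 - u) * s l + u * r k)).
exists (mm (mm S Z) (ad U)); rewrite phi_expand; apply: eq_bigr => lk _.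
by apply: quad_eq => //; exact: mix_pos.
Qed.

(** Klein's inequality D(rho || sigma) >= 0 for equal traces: [ln x <= x - 1] at [x = s / r] is
    summed against [weight], and the linear terms cancel because the squared overlaps form a doubly
    stochastic matrix. *)
Lemma klein : (forall l, s l = 0 -> dgl S rho l = 0) -> \sum_l s l = \sum_k r k ->
  \sum_l dgl S rho l * ln (s l) <= xlnx r.
Proof.
move=> supp sr; rewrite -sum_weightl /xlnx -(sum_weightr (fun k => ln (r k))).
rewrite -subr_ge0 -sumrB.
have z0 : \sum_lk sqn (overlap lk.1 lk.2) * (r lk.2 - s lk.1) = 0.
  under eq_bigr do rewrite mulrBr.
  rewrite sumrB -(pair_bigA _ (fun l k => sqn (overlap l k) * r k)) /=.
  rewrite -(pair_bigA _ (fun l k => sqn (overlap l k) * s l)) /=.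
  rewrite exchange_big /=; under eq_bigr do rewrite -mulr_suml overlapr mul1r.
  under [X in _ - X]eq_bigr do rewrite -mulr_suml overlapl mul1r.
  by rewrite sr subrr.
rewrite -[X in X <= _]z0; apply: ler_sum => lk _; have [w0|wn0] := eqVneq (weight lk) 0.
  rewrite w0 !mul0r subrr mulrBr -/(weight lk) w0 sub0r oppr_le0.
  by rewrite mulr_ge0 // sqn_ge0.
have [s0 r0] := weight_pos supp wn0.
rewrite -mulrBr /weight -mulrA ler_wpM2l ?sqn_ge0 //.
have h : ln (s lk.1) - ln (r lk.2) <= s lk.1 / r lk.2 - 1.
  have x0 : 0 < s lk.1 / r lk.2 by rewrite divr_gt0.
  rewrite -ln_div ?posrE // -{1}(subrKC 1 (s lk.1 / r lk.2)); apply: le_ln1Dx.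
  by rewrite -subr_gt0 opprK subrK.
have -> : r lk.2 - s lk.1 = r lk.2 * (1 - s lk.1 / r lk.2).
  by field; rewrite gt_eqF.
by rewrite ler_pM2l // -opprB -[leRHS]opprB lerN2.
Qed.

End Diagonalized.

Lemma sum_pair (V : nmodType) (I J : finType) (F : I * J -> V) :
  \sum_x F x = \sum_i \sum_j F (i, j).
Proof.
by rewrite (pair_bigA _ (fun i j => F (i, j))); apply: eq_bigr => -[].
Qed.

(** * Partial trace and monotonicity of relative entropy *)

Section PartialTrace.
Variables (I J : finType).

Definition ext (Y : Mat R J) : Mat R (I * J)%type :=
  fun x y => (x.1 == y.1)%:R * Y x.2 y.2.

Lemma ad_ext Y : ad (ext Y) = ext (ad Y).
Proof.
apply/funext => x; apply/funext => y.
by rewrite /ad /ext rmorphM rmorph_nat eq_sym.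
Qed.

Lemma mm_ext Y Y' : mm (ext Y) (ext Y') = ext (mm Y Y').
Proof.
apply/funext => x; apply/funext => y; rewrite /mm /ext.
rewrite -(pair_bigA _ (fun i j => (x.1 == i)%:R * Y x.2 j *
  ((i == y.1)%:R * Y' j y.2))) /=.
rewrite -(sum_deltal x.1 (fun i => (i == y.1)%:R * \sum_j Y x.2 j * Y' j y.2)).
apply: eq_bigr => i _; rewrite !mulr_sumr; apply: eq_bigr => j _; ring.
Qed.

Lemma trace_ext (X : Mat R (I * J)%type) Y :
  trace (mm X (ext Y)) = trace (mm (ptrace1 X) Y).
Proof.
rewrite /trace /mm /ptrace1.
rewrite sum_pair exchange_big /=; apply: eq_bigr => j _.
under [RHS]eq_bigr do rewrite mulr_suml.
rewrite [RHS]exchange_big /=; apply: eq_bigr => i _.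
rewrite sum_pair exchange_big /=; apply: eq_bigr => j' _.
rewrite -(sum_deltar i (fun i' => X (i, j) (i', j') * Y j' j)).
by apply: eq_bigr => i' _; rewrite /ext /=; ring.
Qed.

(** [ext] respects products and adjoints and is dual to the partial trace, so each of the three
    traces in [phi] reduces to the marginals. *)
Lemma phi_ext u (rho sigma : Mat R (I * J)%type) Y :
  phi u rho sigma (ext Y) = phi u (ptrace1 rho) (ptrace1 sigma) Y.
Proof. by rewrite /phi ad_ext !mm_ext !trace_ext. Qed.

Lemma trace_ptrace1 (X : Mat R (I * J)%type) : trace (ptrace1 X) = trace X.
Proof.
by rewrite /trace /ptrace1 sum_pair exchange_big.
Qed.

(* [D(rho || sigma) >= D(rho_J || sigma_J)], with the relative entropies
   expanded in eigenbases. *)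
Lemma relative_entropy_mono (K L K' L' : finType) (rho sigma : Mat R (I * J)%type)
  (U : I * J -> K -> C) r (S : I * J -> L -> C) s
  (P : J -> K' -> C) p (Q : J -> L' -> C) q :
  spec rho U r -> spec sigma S s ->
  spec (ptrace1 rho) P p -> spec (ptrace1 sigma) Q q ->
  (forall k, 0 <= r k) -> (forall l, 0 <= s l) ->
  (forall k, 0 <= p k) -> (forall l, 0 <= q l) ->
  (forall l, s l = 0 -> dgl S rho l = 0) ->
  (forall l, q l = 0 -> dgl Q (ptrace1 rho) l = 0) ->
  \sum_l dgl S rho l * ln (s l) - \sum_l dgl Q (ptrace1 rho) l * ln (q l) <=
  xlnx r - xlnx p.
Proof.
move=> spr sps spp spq r0 s0 p0 q0 supp supp'.
rewrite -(sum_weightl S spr) -(sum_weightl Q spp) /xlnx.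
rewrite -(sum_weightr spr sps (fun k => ln (r k))).
rewrite -(sum_weightr spp spq (fun k => ln (p k))).
apply: (ln_interpolation (s := fun lk => s lk.1) (s' := fun lk => q lk.1)
  (r := fun lk => r lk.2) (r' := fun lk => p lk.2)).
- exact: (weight_pos spr r0 s0 supp).
- exact: (weight_pos spp p0 q0 supp').
- under eq_bigr do rewrite -[weight _ _ _ _]mulr1.
  rewrite (sum_weightr spr sps (fun=> 1)).
  under [RHS]eq_bigr do rewrite -[weight _ _ _ _]mulr1.
  rewrite (sum_weightr spp spq (fun=> 1)).
  under eq_bigr do rewrite mulr1.
  under [RHS]eq_bigr do rewrite mulr1.
  by rewrite (sum_eigenvalues spr) (sum_eigenvalues spp) trace_ptrace1.
(* The optimal [Y] for the marginals, extended by the identity, is a trial operator for the full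
   pair. *)
move=> u u01; have [Y YE] := phi_max spp spq p0 q0 u01.
by move: YE; rewrite /resolvent => <-; rewrite -phi_ext; apply: phi_le.
Qed.

End PartialTrace.
End RelativeEntropy.

(** * Indices as tuples over the channel uses *)

Section Coordinates.
Variables (n : nat) (K X : finType).

(* [co] identifies the index type [K] with the [n]-tuples over [X]. *)
Definition coords (co : K -> 'I_n -> X) :=
  bijective (fun k => [ffun j => co k j] : {ffun 'I_n -> X}).

Variable co : K -> 'I_n -> X.
Hypothesis coP : coords co.

Lemma big_coord (S : comPzSemiRingType) (F : 'I_n -> X -> S) :
  \sum_k \prod_j F j (co k j) = \prod_j \sum_a F j a.
Proof.
rewrite bigA_distr_bigA (reindex (fun k => [ffun j => co k j])) /=; last first.
  exact: onW_bij.
by apply: eq_bigr => k _; apply: eq_bigr => j _; rewrite ffunE.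
Qed.

Lemma big_coord2 (S : comPzSemiRingType) (F : 'I_n -> X -> X -> S) :
  \sum_k \sum_k' \prod_j F j (co k j) (co k' j) = \prod_j \sum_a \sum_b F j a b.
Proof.
rewrite -(big_coord (fun j a => \sum_b F j a b)); apply: eq_bigr => k _.
exact: (big_coord (fun j b => F j (co k j) b)).
Qed.

Lemma delta_coord (S : comPzSemiRingType) k k' :
  (k == k')%:R = \prod_j (co k j == co k' j)%:R :> S.
Proof.
case: eqP => [->|kk']; first by rewrite big1 // => j _; rewrite eqxx.
have [j /eqP jP] : exists j, co k j != co k' j.
  apply/existsP; apply: contra_notT kk'; rewrite negb_exists => /forallP h.
  apply: (bij_inj coP); apply/ffunP => j; rewrite !ffunE.
  by have := h j; rewrite negbK => /eqP.
by rewrite (bigD1 j) //= (introF eqP jP) mul0r.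
Qed.

End Coordinates.

Lemma exchange_big3 (V : nmodType) (I J K : finType) (F : I -> J -> K -> V) :
  \sum_i \sum_j \sum_k F i j k = \sum_k \sum_i \sum_j F i j k.
Proof.
rewrite [RHS]exchange_big; apply: eq_bigr => i _; exact: exchange_big.
Qed.

Lemma exchange_big4 (V : nmodType) (I J K L : finType) (F : I -> J -> K -> L -> V) :
  \sum_i \sum_j \sum_k \sum_l F i j k l = \sum_k \sum_l \sum_i \sum_j F i j k l.
Proof. by rewrite exchange_big3; apply: eq_bigr => k _; exact: exchange_big3. Qed.

(** * Tensor products and one-site marginals *)

Section Tensor.
Variable R : realType.
Local Notation C := (R[i]).
Variable n : nat.

(** Coordinates are arbitrary maps instead of literal tuples, so that one notion serves outputs,
    pairs of outputs and environments, and inputs grouped by sender. *)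
Definition tens (K L X Y : finType) (co : K -> 'I_n -> X) (co' : L -> 'I_n -> Y)
  (A : 'I_n -> X -> Y -> C) : K -> L -> C :=
  fun k l => \prod_j A j (co k j) (co' l j).

Lemma mm_tens (K L M X Y Z : finType) (co1 : K -> 'I_n -> X) (co2 : L -> 'I_n -> Y)
  (co3 : M -> 'I_n -> Z) A B : coords co2 ->
  mm (tens co1 co2 A) (tens co2 co3 B) = tens co1 co3 (fun j => mm (A j) (B j)).
Proof.
move=> co2P; apply/funext => k; apply/funext => m; rewrite /mm /tens.
rewrite -(big_coord co2P (fun j y => A j (co1 k j) y * B j y (co3 m j))).
by apply: eq_bigr => l _; rewrite big_split.
Qed.

Lemma ad_tens (K L X Y : finType) (co : K -> 'I_n -> X) (co' : L -> 'I_n -> Y) A :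
  ad (tens co co' A) = tens co' co (fun j => ad (A j)).
Proof.
by apply/funext => l; apply/funext => k; rewrite /ad /tens rmorph_prod.
Qed.

Lemma tens_id (K X : finType) (co : K -> 'I_n -> X) (A : 'I_n -> X -> X -> C) :
  coords co -> (forall j, A j = @id_mat R X) -> tens co co A = @id_mat R K.
Proof.
move=> coP AE; apply/funext => k; apply/funext => k'.
rewrite /id_mat (delta_coord coP); apply: eq_bigr => j _.
by rewrite AE.
Qed.

Lemma tens_dg (K X : finType) (co : K -> 'I_n -> X) (d : 'I_n -> X -> R) :
  coords co -> tens co co (fun j => dg (d j)) = dg (fun k => \prod_j d j (co k j)).
Proof.
move=> coP; apply/funext => k; apply/funext => k'.
by rewrite /dg (delta_coord coP) rmorph_prod -big_split.
Qed.

Lemma spec_tens (K L X Y : finType) (co : K -> 'I_n -> X) (co' : L -> 'I_n -> Y)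
  (A : 'I_n -> Mat R X) (U : 'I_n -> X -> Y -> C) (d : 'I_n -> Y -> R) :
  coords co -> coords co' -> (forall j, spec (A j) (U j) (d j)) ->
  spec (tens co co A) (tens co co' U) (fun l => \prod_j d j (co' l j)).
Proof.
move=> coP coP' sp; split.
- rewrite ad_tens mm_tens //; apply: tens_id => // j.
  by case: (sp j).
- rewrite ad_tens mm_tens //; apply: tens_id => // j.
  by case: (sp j).
rewrite -tens_dg // ad_tens !mm_tens //; congr tens; apply/funext => j.
by case: (sp j).
Qed.

Section LnProduct.
Variables (L Y : finType) (co : L -> 'I_n -> Y) (D : L -> R) (q : 'I_n -> Y -> R).
Hypotheses (D_ge0 : forall l, 0 <= D l) (q_ge0 : forall i m, 0 <= q i m).
Hypothesis D_marg : forall i m, \sum_(l | co l i == m) D l = q i m.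

(** A vanishing factor is a vanishing marginal, hence a zero sum of nonnegative terms among which is
    [D l]. *)
Lemma marginal_support l : \prod_j q j (co l j) = 0 -> D l = 0.
Proof.
move=> /eqP/prodf_eq0[j _]; rewrite -D_marg psumr_eq0; last by move=> *.
by move=> /allP/(_ l (mem_index_enum _)); rewrite eqxx /= => /eqP.
Qed.

(** On the support of [D] no factor vanishes, so the logarithm splits; each summand depends on one
    coordinate and sees only that marginal. *)
Lemma sum_ln_prod : \sum_l D l * ln (\prod_j q j (co l j)) = \sum_i xlnx (q i).
Proof.
transitivity (\sum_l \sum_i D l * ln (q i (co l i))).
  apply: eq_bigr => l _; rewrite -mulr_sumr.
  have [->|Dl] := eqVneq (D l) 0; first by rewrite !mul0r.
  congr (_ * _).
  have : forall j, 0 < q j (co l j).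
    move=> j; rewrite lt_neqAle q_ge0 andbT eq_sym.
    apply: contraNneq Dl => qj0; apply/eqP/marginal_support.
    by rewrite (bigD1 j) //= qj0 mul0r.
  move=> q_gt0.
  suff [_ //] : 0 < \prod_j q j (co l j) /\
    ln (\prod_j q j (co l j)) = \sum_i ln (q i (co l i)).
  elim/big_rec2: _ => [|j y x _ [x0 xE]]; first by rewrite ltr01 ln1.
  by rewrite mulr_gt0 // lnM ?posrE // xE.
rewrite exchange_big; apply: eq_bigr => i _.
rewrite (partition_big (fun l => co l i) predT) //=; apply: eq_bigr => m _.
by rewrite -{1}D_marg mulr_suml; apply: eq_bigr => l /eqP ->.
Qed.

End LnProduct.

Section Marginal.
Variables (K X : finType) (co : K -> 'I_n -> X).
Hypothesis coP : coords co.

Definition loc (i : 'I_n) (g : X -> X -> C) : Mat R K :=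
  fun k k' => \prod_j (if j == i then g (co k j) (co k' j)
                       else (co k j == co k' j)%:R).

Lemma locE i g k k' : loc i g k k' = g (co k i) (co k' i) *
  \prod_(j | j != i) (co k j == co k' j)%:R.
Proof.
rewrite /loc (bigD1 i) //= eqxx; congr (_ * _).
by apply: eq_bigr => j /negPf ->.
Qed.

(** The reduced operator at site [i], obtained by pairing with one-site matrix units; this avoids
    splitting [K] into one site and the rest. *)
Definition marg (rho : Mat R K) (i : 'I_n) : Mat R X := fun a a' =>
  \sum_k \sum_k' rho k k' * loc i (fun b b' => (b == a)%:R * (b' == a')%:R) k k'.

(** Linearity in [g] extends the defining pairing from matrix units to all one-site kernels; later
    marginals are computed through this duality. *)
Lemma margE rho i (g : X -> X -> C) :
  \sum_k \sum_k' rho k k' * loc i g k k' =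
  \sum_a \sum_a' marg rho i a a' * g a a'.
Proof.
have lin k k' : loc i g k k' = \sum_a \sum_a'
    g a a' * loc i (fun b b' => (b == a)%:R * (b' == a')%:R) k k'.
  rewrite locE; set P := \prod_(j | _) _.
  rewrite -(sum_deltal (co k i) (fun a => g a (co k' i))) mulr_suml.
  apply: eq_bigr => a _; rewrite -(sum_deltal (co k' i) (fun a' => g a a')).
  rewrite mulr_sumr mulr_suml; apply: eq_bigr => a' _; rewrite locE -/P; ring.
transitivity (\sum_a \sum_a' \sum_k \sum_k'
    rho k k' * loc i (fun b b' => (b == a)%:R * (b' == a')%:R) k k' * g a a').
  rewrite exchange_big4; apply: eq_bigr => k _; apply: eq_bigr => k' _.
  rewrite lin mulr_sumr; apply: eq_bigr => a _; rewrite mulr_sumr.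
  by apply: eq_bigr => a' _; ring.
apply: eq_bigr => a _; apply: eq_bigr => a' _; rewrite /marg mulr_suml.
by apply: eq_bigr => k _; rewrite mulr_suml.
Qed.

Lemma trace_marg rho i : trace (marg rho i) = trace rho.
Proof.
transitivity (\sum_a \sum_a' marg rho i a a' * (a == a')%:R).
  apply: eq_bigr => a _; rewrite -(sum_deltar a (fun a' => marg rho i a a')).
  by apply: eq_bigr => a' _; rewrite eq_sym.
rewrite -margE; apply: eq_bigr => k _.
rewrite -(sum_deltar k (fun k' => rho k k')); apply: eq_bigr => k' _.
congr (_ * _); rewrite eq_sym (delta_coord coP); apply: eq_bigr => j _.
by case: ifP.
Qed.

(** The identity on the other sites is a sum of rank-one kernels [w c], which turns the form of the
    marginal at [v] into a sum of values of the form of [rho]. *)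
Lemma psd_marg rho i : psd rho -> psd (marg rho i).
Proof.
move=> rp v; case: (pickP X) => [a0 _|X0]; last by rewrite big_pred0.
(* Pinning site [i] of [c] to [a0] makes [c] run exactly once over the configurations of the other
   sites. *)
pose w c k : C := (co c i == a0)%:R *
  \prod_(j | j != i) (co c j == co k j)%:R.
have restE k k' : \prod_(j | j != i) (co k j == co k' j)%:R =
    \sum_c w c k * w c k'.
  pose F j b : C := if j == i then (b == a0)%:R
    else (b == co k j)%:R * (b == co k' j)%:R.
  transitivity (\prod_j \sum_b F j b).
    rewrite [RHS](bigD1 i) //= /F eqxx.
    under [X in X * _]eq_bigr => b _ do rewrite -[_%:R]mul1r.
    rewrite sum_deltar mul1r; apply: eq_bigr => j /negPf ->.
    rewrite -(sum_deltar (co k j) (fun b => (b == co k' j)%:R)).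
    by apply: eq_bigr => b _; rewrite mulrC.
  rewrite -(big_coord coP); apply: eq_bigr => c _.
  rewrite (bigD1 i) //= /F eqxx /w mulrACA -big_split -natrM mulnb andbb.
  by congr (_ * _); apply: eq_bigr => j /negPf ->.
have wr c k : (w c k)^* = w c k.
  by rewrite /w rmorphM rmorph_prod rmorph_nat; under eq_bigr do rewrite rmorph_nat.
have -> : \sum_a \sum_a' (v a)^* * marg rho i a a' * v a' =
    \sum_c \sum_k \sum_k' (v (co k i) * w c k)^* * rho k k' * (v (co k' i) * w c k').
  transitivity (\sum_a \sum_a' marg rho i a a' * ((v a)^* * v a')).
    by apply: eq_bigr => a _; apply: eq_bigr => a' _; rewrite mulrAC mulrC.
  rewrite -(margE rho i (fun a a' => (v a)^* * v a')).
  rewrite -[RHS]exchange_big3; apply: eq_bigr => k _; apply: eq_bigr => k' _.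
  rewrite locE restE !mulr_sumr; apply: eq_bigr => c _.
  by rewrite rmorphM /= wr; ring.
by apply: sumr_ge0 => c _; apply: rp.
Qed.

(** Summing over the outcomes at the other sites gives identities there, by completeness of each
    basis [Q j]; what remains is a one-site kernel, evaluated by [margE]. *)
Lemma dgl_tens (L Y : finType) (co' : L -> 'I_n -> Y) (Q : 'I_n -> X -> Y -> C)
  (rho : Mat R K) i m : coords co' -> (forall j, mm (Q j) (ad (Q j)) = @id_mat R X) ->
  \sum_(l | co' l i == m) dgl (tens co co' Q) rho l = dgl (Q i) (marg rho i) m.
Proof.
move=> coP' QQ.
have dglE (I1 L1 : finType) (S : I1 -> L1 -> C) (r1 : Mat R I1) l :
    dgl S r1 l = complex.Re (\sum_k \sum_k' r1 k k' * ((S k l)^* * S k' l)).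
  congr complex.Re; rewrite /mm exchange_big; apply: eq_bigr => k' _.
  rewrite mulr_suml; apply: eq_bigr => k _; rewrite /ad; ring.
rewrite dglE -(margE rho i (fun a a' => (Q i a m)^* * Q i a' m)).
under eq_bigr do rewrite dglE.
rewrite -Re_sum; congr complex.Re.
rewrite exchange_big; apply: eq_bigr => k _.
rewrite exchange_big; apply: eq_bigr => k' _; rewrite -mulr_sumr; congr (_ * _).
pose F j y : C := (if j == i then (y == m)%:R else 1) *
  ((Q j (co k j) y)^* * Q j (co k' j) y).
transitivity (\sum_l \prod_j F j (co' l j)).
  rewrite big_mkcond; apply: eq_bigr => l _; rewrite big_split /= (bigD1 i) //= eqxx.
  rewrite [X in _ * X * _]big1 ?mulr1; last by move=> j /negPf ->.
  case: ifP => _; rewrite ?mul0r // mul1r big_split /= /tens.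
  by rewrite rmorph_prod.
rewrite (big_coord coP'); apply: eq_bigr => j _; rewrite /F.
case: ifP => [/eqP ->|_].
  rewrite -(sum_deltal m (fun y => (Q i (co k i) y)^* * Q i (co k' i) y)).
  by apply: eq_bigr => y _; rewrite eq_sym.
have := congr1 (fun f : Mat R X => f (co k' j) (co k j)) (QQ j).
rewrite /id_mat eq_sym => <-; apply: eq_bigr => y _.
by rewrite mul1r mulrC.
Qed.

Lemma dgl_spec (I1 L1 : finType) (S : I1 -> L1 -> C) (r1 : Mat R I1) lam l :
  spec r1 S lam -> dgl S r1 l = lam l.
Proof.
move=> [S1 S2 ->]; rewrite /dgl !mmA S1 mm1l -mmA S1 mm1r /dg eqxx mul1r.
by [].
Qed.

End Marginal.

Lemma psd_specs (X : finType) (A : 'I_n -> Mat R X) : (forall i, psd (A i)) ->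
  exists (U : 'I_n -> Mat R X) (d : 'I_n -> X -> R),
  (forall i, spec (A i) (U i) (d i)) /\ forall i m, 0 <= d i m.
Proof.
move=> Ap.
have /choice[f fP] : forall i, exists f : Mat R X * (X -> R),
    spec (A i) f.1 f.2 /\ forall m, 0 <= f.2 m.
  by move=> i; have [U [d h]] := psd_spec (Ap i); exists (U, d).
by exists (fun i => (f i).1), (fun i => (f i).2); split=> i; case: (fP i).
Qed.

Lemma coords_ffun (X : finType) : coords (fun (z : {ffun 'I_n -> X}) j => z j).
Proof.
by exists id => z; apply/ffunP => j; rewrite ?ffunE.
Qed.

End Tensor.

(** * Additivity, subadditivity and total correlation *)

Section Multipartite.
Variable R : realType.
Local Notation C := (R[i]).
Variable n : nat.

(** The spectrum of the product is a product distribution, and unit traces make its marginals the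
    individual spectra. *)
Lemma entropy_tens (K X : finType) (co : K -> 'I_n -> X) (A : 'I_n -> Mat R X) :
  coords co -> (forall j, psd (A j)) -> (forall j, trace (A j) = 1) ->
  entropy (tens co co A) = \sum_j entropy (A j).
Proof.
move=> coP Ap At; have [U [d [sp d_ge0]]] := psd_specs Ap.
pose coL (z : {ffun 'I_n -> X}) j := z j.
have coLP : coords coL by exact: coords_ffun.
have d1 j : \sum_y d j y = 1 by rewrite (sum_eigenvalues (sp j)) At.
rewrite (entropy_spec (spec_tens coP coLP sp)); last by move=> l; exact: prodr_ge0.
under eq_bigr do rewrite (entropy_spec (sp _)) //.
rewrite sumrN; congr (- _); rewrite /xlnx.
apply: (sum_ln_prod (D := fun l => \prod_j d j (coL l j))) => //.
  by move=> l; exact: prodr_ge0.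
move=> i m; pose F j y := (if j == i then (y == m)%:R else 1) * d j y.
transitivity (\sum_l \prod_j F j (coL l j)).
  rewrite big_mkcond; apply: eq_bigr => l _.
  rewrite big_split /= [X in _ = X * _](bigD1 i) //= eqxx.
  rewrite [X in _ * X * _]big1 ?mulr1; last by move=> j /negPf ->.
  by case: ifP => _; rewrite ?mul0r // mul1r.
rewrite (big_coord coLP) (bigD1 i) //= [X in _ * X]big1 /F; last first.
  by move=> j /negPf ->; under eq_bigr do rewrite mul1r.
rewrite mulr1 eqxx -(sum_deltal m (fun y => d i y)).
by apply: eq_bigr => y _; rewrite eq_sym.
Qed.

Section Info.
Variables (K X : finType) (co : K -> 'I_n -> X) (rho : Mat R K).
Hypotheses (coP : coords co) (rho_psd : psd rho).

(** Prepares the comparison of [rho] with the product of its marginals: the support condition holds,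
    and -Tr(rho ln sigma) is the sum of the marginal entropies. *)
Lemma info_expansion (q : 'I_n -> X -> R) (Q : 'I_n -> Mat R X) :
  (forall i, spec (marg co rho i) (Q i) (q i)) -> (forall i m, 0 <= q i m) ->
  let s (l : {ffun 'I_n -> X}) := \prod_j q j (l j) in
  let S := tens co (fun (l : {ffun 'I_n -> X}) j => l j) Q in
  [/\ forall l, 0 <= s l, forall l, s l = 0 -> dgl S rho l = 0 &
      \sum_l dgl S rho l * ln (s l) = - \sum_i entropy (marg co rho i)].
Proof.
move=> sp q_ge0 s S; have [U [r [spr r_ge0]]] := psd_spec rho_psd.
have D_ge0 l : 0 <= dgl S rho l by exact: (dgl_ge0 S spr).
have D_marg i m : \sum_(l : {ffun 'I_n -> X} | l i == m) dgl S rho l = q i m.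
  rewrite dgl_tens //; last by move=> j; case: (sp j).
    exact: dgl_spec.
  exact: coords_ffun.
split; first by move=> l; exact: prodr_ge0.
  by move=> l; exact: (marginal_support D_ge0 D_marg).
rewrite (sum_ln_prod D_ge0 q_ge0 D_marg) -sumrN; apply: eq_bigr => i _.
by rewrite (entropy_spec (sp i)) ?opprK.
Qed.

(** Klein's inequality with the product of the marginals as second argument. *)
Lemma entropy_subadditive : trace rho = 1 ->
  entropy rho <= \sum_i entropy (marg co rho i).
Proof.
move=> tr1; have [U [r [spr r_ge0]]] := psd_spec rho_psd.
have [Q [q [sp q_ge0]]] := psd_specs (fun i => psd_marg coP i rho_psd).
have [s_ge0 supp lnE] := info_expansion sp q_ge0.
have sps := spec_tens coP (coords_ffun n X) sp.
have := klein spr sps r_ge0 s_ge0 supp; rewrite lnE (entropy_spec spr) //.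
rewrite lerNl => -> //.
rewrite (big_coord (coords_ffun n X)) (sum_eigenvalues spr) tr1 /= big1 // => j _.
by rewrite (sum_eigenvalues (sp j)) trace_marg // tr1.
Qed.

End Info.

Section Pairs.
Variables (I J X Y : finType) (coI : I -> 'I_n -> X) (coJ : J -> 'I_n -> Y).

Definition co_pair (ij : I * J) (l : 'I_n) : X * Y := (coI ij.1 l, coJ ij.2 l).

Lemma coords_pair : coords coI -> coords coJ -> coords co_pair.
Proof.
move=> [f fK Kf] [g gK Kg].
exists (fun h : {ffun 'I_n -> X * Y} =>
  (f [ffun j => (h j).1], g [ffun j => (h j).2])).
  move=> [a b]; apply: (congr2 pair); [rewrite -[RHS]fK | rewrite -[RHS]gK];
    by congr (_ _); apply/ffunP => l; rewrite !ffunE.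
move=> h; apply/ffunP => l; rewrite ffunE /co_pair /=.
have := congr1 (fun z : {ffun 'I_n -> X} => z l) (Kf [ffun j => (h j).1]).
have := congr1 (fun z : {ffun 'I_n -> Y} => z l) (Kg [ffun j => (h j).2]).
by rewrite !ffunE => -> ->; case: (h l).
Qed.

Lemma ptrace1_tens (A : 'I_n -> Mat R (X * Y)%type) : coords coI ->
  ptrace1 (tens co_pair co_pair A) = tens coJ coJ (fun j => ptrace1 (A j)).
Proof.
move=> coIP; apply/funext => j; apply/funext => j'; rewrite /ptrace1 /tens.
exact: (big_coord coIP (fun l x => A l (x, coJ j l) (x, coJ j' l))).
Qed.

Lemma ptrace2_tens (A : 'I_n -> Mat R (X * Y)%type) : coords coJ ->
  ptrace2 (tens co_pair co_pair A) = tens coI coI (fun j => ptrace2 (A j)).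
Proof.
move=> coJP; apply/funext => j; apply/funext => j'; rewrite /ptrace2 /tens.
exact: (big_coord coJP (fun l x => A l (coI j l, x) (coI j' l, x))).
Qed.

(** Both sides pair [rho] with the same kernel: at site [i] a matrix unit on the second factor and
    the identity on the first, and the identity at all other sites. *)
Lemma marg_ptrace1 (rho : Mat R (I * J)%type) i : coords coI ->
  marg coJ (ptrace1 rho) i = ptrace1 (marg co_pair rho i).
Proof.
move=> coIP; apply/funext => e; apply/funext => e'.
pose g (x x' : X * Y) : C := (x.1 == x'.1)%:R * ((x.2 == e)%:R * (x'.2 == e')%:R).
transitivity (\sum_x \sum_x' marg co_pair rho i x x' * g x x'); last first.
  rewrite sum_pair /ptrace1; apply: eq_bigr => a _.
  rewrite -(sum_deltar e (fun y => marg co_pair rho i (a, y) (a, e'))).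
  apply: eq_bigr => y _; rewrite sum_pair exchange_big /=.
  rewrite -(sum_deltar e' (fun y' => marg co_pair rho i (a, y) (a, y'))) mulr_suml.
  apply: eq_bigr => y' _.
  rewrite -(sum_deltar a (fun a' => marg co_pair rho i (a, y) (a', y'))) !mulr_suml.
  by apply: eq_bigr => a' _; rewrite /g /= eq_sym; ring.
rewrite -(margE co_pair rho i g) /marg /ptrace1 [RHS]sum_pair [RHS]exchange_big.
apply: eq_bigr => j _ /=.
under eq_bigr => j' _ do rewrite mulr_suml.
rewrite exchange_big; apply: eq_bigr => b _ /=.
rewrite [RHS]sum_pair [RHS]exchange_big; apply: eq_bigr => j' _ /=.
rewrite -(sum_deltar b (fun b' => rho (b, j) (b', j'))) mulr_suml.
apply: eq_bigr => b' _; rewrite -mulrA; congr (_ * _).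
rewrite eq_sym (delta_coord coIP) /loc -big_split; apply: eq_bigr => l _ /=.
case: ifP => // _; rewrite -natrM mulnb /co_pair /=.
by rewrite xpair_eqE.
Qed.

Lemma marg_ptrace2 (rho : Mat R (I * J)%type) i : coords coJ ->
  marg coI (ptrace2 rho) i = ptrace2 (marg co_pair rho i).
Proof.
move=> coJP; apply/funext => e; apply/funext => e'.
pose g (x x' : X * Y) : C := (x.2 == x'.2)%:R * ((x.1 == e)%:R * (x'.1 == e')%:R).
transitivity (\sum_x \sum_x' marg co_pair rho i x x' * g x x'); last first.
  rewrite sum_pair /ptrace2 exchange_big; apply: eq_bigr => a _ /=.
  rewrite -(sum_deltar e (fun y => marg co_pair rho i (y, a) (e', a))).
  apply: eq_bigr => y _; rewrite sum_pair /=.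
  rewrite -(sum_deltar e' (fun y' => marg co_pair rho i (y, a) (y', a))) mulr_suml.
  apply: eq_bigr => y' _.
  rewrite -(sum_deltar a (fun a' => marg co_pair rho i (y, a) (y', a'))) !mulr_suml.
  by apply: eq_bigr => a' _; rewrite /g /= eq_sym; ring.
rewrite -(margE co_pair rho i g) /marg /ptrace2 sum_pair.
apply: eq_bigr => j _ /=.
under eq_bigr => j' _ do rewrite mulr_suml.
rewrite exchange_big; apply: eq_bigr => b _ /=.
rewrite sum_pair; apply: eq_bigr => j' _ /=.
rewrite -(sum_deltar b (fun b' => rho (j, b) (j', b'))) mulr_suml.
apply: eq_bigr => b' _; rewrite -mulrA; congr (_ * _).
rewrite eq_sym (delta_coord coJP) /loc -big_split; apply: eq_bigr => l _ /=.
case: ifP => // _; rewrite -natrM mulnb /co_pair /=.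
by rewrite xpair_eqE andbC.
Qed.

Lemma psd_ptrace1 (rho : Mat R (I * J)%type) : psd rho -> psd (ptrace1 rho).
Proof.
move=> rp v.
have -> : \sum_j \sum_j' (v j)^* * ptrace1 rho j j' * v j' =
    \sum_i \sum_x \sum_x' ((x.1 == i)%:R * v x.2)^* * rho x x' * ((x'.1 == i)%:R * v x'.2).
  transitivity (\sum_i \sum_j \sum_j' (v j)^* * rho (i, j) (i, j') * v j').
    rewrite -[RHS]exchange_big3; apply: eq_bigr => j _; apply: eq_bigr => j' _.
    by rewrite /ptrace1 mulr_sumr mulr_suml.
  apply: eq_bigr => i _; rewrite [RHS]sum_pair [RHS]exchange_big; apply: eq_bigr => j _ /=.
  under [RHS]eq_bigr => i1 _ do rewrite sum_pair exchange_big /=.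
  rewrite [RHS]exchange_big /=; apply: eq_bigr => j' _.
  rewrite -(sum_deltal i (fun i1 => (v j)^* * rho (i1, j) (i, j') * v j')).
  apply: eq_bigr => i1 _.
  rewrite -(sum_deltal i (fun i2 => (v j)^* * rho (i1, j) (i2, j') * v j')) mulr_sumr.
  apply: eq_bigr => i2 _; rewrite rmorphM rmorph_nat (eq_sym i1) (eq_sym i2); ring.
by apply: sumr_ge0 => i _; apply: rp.
Qed.

(* [D(rho || (x)_i rho_i) = sum_i S(rho_i) - S(rho)] decreases under the
   product partial trace. *)
Lemma total_correlation_mono (rho : Mat R (I * J)%type) :
  coords coI -> coords coJ -> psd rho ->
  \sum_i entropy (marg coJ (ptrace1 rho) i) - entropy (ptrace1 rho) <=
  \sum_i entropy (marg co_pair rho i) - entropy rho.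
Proof.
move=> coIP coJP rp; have rp1 := psd_ptrace1 rp.
have coIJP := coords_pair coIP coJP.
have [U [r [spr r_ge0]]] := psd_spec rp.
have [P [p [spp p_ge0]]] := psd_spec rp1.
have [S [s [sps s_ge0]]] := psd_specs (fun i => psd_marg coIJP i rp).
have [Q [q [spq q_ge0]]] := psd_specs (fun i => psd_marg coJP i rp1).
have [s0 supp sE] := info_expansion rp sps s_ge0.
have [q0 supp' qE] := info_expansion rp1 spq q_ge0.
have Sps := spec_tens coIJP (coords_ffun _ _) sps.
have Spq := spec_tens coJP (coords_ffun _ _) spq.
(* The partial trace of the product of marginals is the product of the marginals of the partial
   trace, so both second arguments fit monotonicity. *)
have margE1 : tens coJ coJ (marg coJ (ptrace1 rho)) =
    ptrace1 (tens co_pair co_pair (marg co_pair rho)).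
  rewrite ptrace1_tens //; congr tens; apply/funext => i; exact: marg_ptrace1.
rewrite margE1 in Spq.
have := relative_entropy_mono spr Sps spp Spq r_ge0 s0 p_ge0 q0 supp supp'.
rewrite sE qE (entropy_spec spr) // (entropy_spec spp) //.
lra.
Qed.

End Pairs.
End Multipartite.

(** * Dependent products over the senders *)

(** The index type varies with [k]; passing to [fprod] makes the choices functions into a tagged
    union, where ordinary distributivity applies. *)
Lemma big_dffun (S : comPzSemiRingType) (s : nat) (T : 'I_s -> finType)
  (F : forall k, T k -> S) :
  \sum_(x : prodT T) \prod_k F k (x k) = \prod_k \sum_a F k a.
Proof.
rewrite (reindex (@dffun_of_fprod _ T)) /=; last exact/onW_bij/dffun_of_fprod_bij.
pose P k : {ffun T k -> S} := [ffun a => F k a].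
transitivity (\sum_(t : fprod T) \prod_(k in 'I_s) P k (t k)).
  by apply: eq_bigr => t _; apply: eq_bigr => k _; rewrite !ffunE.
transitivity (\prod_k \sum_(j in tagged_with T k) untag 0 (P k) j).
  by rewrite bigA_distr_big_dep big_fprod.
apply: eq_bigr => k _; transitivity (\sum_a P k a).
  exact: (esym (big_tag (fun k a => P k a) k)).
by apply: eq_bigr => a _; rewrite ffunE.
Qed.

Lemma big_dffun2 (S : comPzSemiRingType) (s : nat) (T : 'I_s -> finType)
  (F : forall k, T k -> T k -> S) :
  \sum_(x : prodT T) \sum_(x' : prodT T) \prod_k F k (x k) (x' k) =
  \prod_k \sum_a \sum_b F k a b.
Proof.
rewrite -(big_dffun (fun k a => \sum_b F k a b)); apply: eq_bigr => x _.
exact: (big_dffun (fun k b => F k (x k) b)).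
Qed.

Lemma delta_dffun (S : comPzSemiRingType) (s : nat) (T : 'I_s -> finType)
  (x x' : prodT T) : (x == x')%:R = \prod_k (x k == x' k)%:R :> S.
Proof.
case: eqP => [->|xx']; first by rewrite big1 // => k _; rewrite eqxx.
have [k /eqP kP] : exists k, x k != x' k.
  apply/existsP; apply: contra_notT xx'; rewrite negb_exists => /forallP h.
  by apply/ffunP => k; have := h k; rewrite negbK => /eqP.
by rewrite (bigD1 k) //= (introF eqP kP) mul0r.
Qed.

(** * Information of an isometry *)

Section Stinespring.
Variable R : realType.
Local Notation C := (R[i]).
Variables (B E P : finType).

Definition stin (V : B * E -> P -> C) (T : Mat R P) : Mat R (B * E)%type :=
  mm (mm V T) (ad V).

(* [I(A';B)] for a purification of the input [T], with the entropies of [A']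
   and [A'B] traded for those of the complementary systems [BE] and [E]. *)
Definition channel_info (V : B * E -> P -> C) (T : Mat R P) : R :=
  entropy (ptrace2 (stin V T)) + entropy (stin V T) - entropy (ptrace1 (stin V T)).

Lemma stinE V T x x' :
  stin V T x x' = \sum_p \sum_p' T p p' * (V x p * (V x' p')^*).
Proof.
rewrite /stin /mm exchange_big; apply: eq_bigr => p' _.
by rewrite mulr_suml; apply: eq_bigr => p _; rewrite /ad; ring.
Qed.

Variable V : B * E -> P -> C.
Hypothesis Viso : mm (ad V) V = @id_mat R P.

Lemma psd_stin T : psd T -> psd (stin V T).
Proof.
move=> /psd_gram[G ->]; rewrite /stin mmA -mmA -ad_mm; exact: psd_mm_ad.
Qed.

Lemma trace_stin T : trace (stin V T) = trace T.
Proof. by rewrite /stin trace_mmC mmA Viso mm1l. Qed.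

End Stinespring.

Section PartialTrace2.
Variables (R : realType) (I J : finType).

Lemma ptrace2_swap (X : Mat R (I * J)%type) :
  ptrace2 X = ptrace1 (fun x y => X (x.2, x.1) (y.2, y.1)).
Proof. by []. Qed.

Lemma psd_ptrace2 (X : Mat R (I * J)%type) : psd X -> psd (ptrace2 X).
Proof.
move=> Xp; rewrite ptrace2_swap; apply: psd_ptrace1 => v.
have := Xp (fun x => v (x.2, x.1)); congr (_ <= _).
have swap (F : I * J -> R[i]) : \sum_x F x = \sum_(x : J * I) F (x.2, x.1).
  by rewrite !sum_pair exchange_big.
rewrite swap; apply: eq_bigr => -[a b] _; rewrite swap.
by apply: eq_bigr => -[c d] _.
Qed.

Lemma trace_ptrace2 (X : Mat R (I * J)%type) : trace (ptrace2 X) = trace X.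
Proof. by rewrite /trace /ptrace2 sum_pair. Qed.

End PartialTrace2.

(** * Information of several uses of an isometry *)

Section TensorPower.
Variable R : realType.
Local Notation C := (R[i]).
Variables (n : nat) (B E P Bn En Q : finType).
Variables (coB : Bn -> 'I_n -> B) (coE : En -> 'I_n -> E) (coQ : Q -> 'I_n -> P).
Hypotheses (coBP : coords coB) (coEP : coords coE) (coQP : coords coQ).
Variable V : B * E -> P -> C.
Hypothesis Viso : mm (ad V) V = @id_mat R P.

Let coBE := co_pair coB coE.
Let coBEP : coords coBE := coords_pair coBP coEP.

Definition stin_pow : Bn * En -> Q -> C := tens coBE coQ (fun=> V).

Lemma stin_pow_iso : mm (ad stin_pow) stin_pow = @id_mat R Q.
Proof. by rewrite ad_tens mm_tens //; apply: tens_id. Qed.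

(** At every use other than [i] the output is traced out, and [Viso] collapses the isometry there to
    the identity on the input. *)
Lemma marg_stin T i : marg coBE (stin stin_pow T) i = stin V (marg coQ T i).
Proof.
apply/funext => a; apply/funext => a'.
pose unit_aa (b b' : B * E) : C := (b == a)%:R * (b' == a')%:R.
rewrite stinE -(margE coQ T i (fun p p' => V a p * (V a' p')^*)) /marg.
under eq_bigr => k _.
  under eq_bigr => k' _.
    rewrite stinE mulr_suml.
    under eq_bigr => q _ do rewrite mulr_suml.
    over.
  over.
rewrite exchange_big4; apply: eq_bigr => q _; apply: eq_bigr => q' _.
under eq_bigr => k _.
  under eq_bigr => k' _ do rewrite -mulrA.
  rewrite -mulr_sumr; over.
rewrite -mulr_sumr; congr (_ * _).
pose F j b b' := V b (coQ q j) * (V b' (coQ q' j))^* *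
  (if j == i then unit_aa b b' else (b == b')%:R).
transitivity (\sum_k \sum_k' \prod_j F j (coBE k j) (coBE k' j)).
  apply: eq_bigr => k _; apply: eq_bigr => k' _.
  by rewrite !big_split /= /stin_pow /tens rmorph_prod.
rewrite (big_coord2 coBEP) /loc; apply: eq_bigr => j _; rewrite /F.
case: ifP => [/eqP ->|_].
  rewrite -(sum_deltar a (fun b => V b (coQ q i) * (V a' (coQ q' i))^*)).
  apply: eq_bigr => b _.
  rewrite -(sum_deltar a' (fun b' => V b (coQ q i) * (V b' (coQ q' i))^*)) mulr_suml.
  by apply: eq_bigr => b' _; rewrite /unit_aa; ring.
have := congr1 (fun f : Mat R P => f (coQ q' j) (coQ q j)) Viso.
rewrite /id_mat eq_sym => <-; apply: eq_bigr => b _.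
rewrite -[RHS](sum_deltal b (fun b' => (V b' (coQ q' j))^* * V b (coQ q j))).
by apply: eq_bigr => b' _; ring.
Qed.

Lemma channel_info_le T : psd T -> trace T = 1 ->
  channel_info stin_pow T <= \sum_i channel_info V (marg coQ T i).
Proof.
move=> Tp T1; set rho := stin stin_pow T.
have rp : psd rho := psd_stin stin_pow Tp.
have r1 : trace rho = 1 by rewrite trace_stin // stin_pow_iso.
(* Discarding the outputs bounds the difference of the [BE] and [E] entropies as a whole; the
   remaining [B] term is left to subadditivity. *)
have h1 := total_correlation_mono coBP coEP rp.
have h2 := entropy_subadditive coBP (psd_ptrace2 rp).
rewrite trace_ptrace2 r1 in h2; have {}h2 := h2 erefl.
rewrite /channel_info sumrB big_split /=.
have e1 : \sum_i entropy (ptrace2 (stin V (marg coQ T i))) =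
    \sum_i entropy (marg coB (ptrace2 rho) i).
  by apply: eq_bigr => i _; rewrite (marg_ptrace2 coB _ _ coEP) marg_stin.
have e2 : \sum_i entropy (ptrace1 (stin V (marg coQ T i))) =
    \sum_i entropy (marg coE (ptrace1 rho) i).
  by apply: eq_bigr => i _; rewrite (marg_ptrace1 coE _ _ coBP) marg_stin.
have e3 : \sum_i entropy (stin V (marg coQ T i)) =
    \sum_i entropy (marg coBE rho i).
  by apply: eq_bigr => i _; rewrite marg_stin.
by rewrite e1 e2 e3; move: h1 h2; rewrite -/coBE -/rho; lra.
Qed.

Lemma channel_info_tens T : psd T -> trace T = 1 ->
  channel_info stin_pow (tens coQ coQ (fun=> T)) = channel_info V T *+ n.
Proof.
move=> Tp T1; have rp := psd_stin V Tp.
have r1 : trace (stin V T) = 1 by rewrite trace_stin.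
have -> : channel_info stin_pow (tens coQ coQ (fun=> T)) =
  entropy (ptrace2 (tens coBE coBE (fun=> stin V T)))
  + entropy (tens coBE coBE (fun=> stin V T))
  - entropy (ptrace1 (tens coBE coBE (fun=> stin V T))).
  by rewrite /channel_info /stin /stin_pow ad_tens !mm_tens.
rewrite ptrace1_tens // ptrace2_tens // !entropy_tens //.
- by rewrite !sumr_const card_ord /channel_info !mulrnDl mulNrn.
- by move=> _; exact: psd_ptrace1.
- by rewrite trace_ptrace1.
- by move=> _; exact: psd_ptrace2.
- by rewrite trace_ptrace2.
Qed.

End TensorPower.

(** * Inputs that are products across senders *)

Section ProductStates.
Variable R : realType.
Local Notation C := (R[i]).
Variables (s : nat) (A : 'I_s -> finType).

(** The tensor product across senders, whose systems may differ; [tens] is the one across channel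
    uses. *)
Definition tau_prod (tau : forall k, Mat R (A k)) : Mat R (prodT A) :=
  fun x x' => \prod_k tau k (x k) (x' k).

Definition state (I : finType) (tau : Mat R I) := psd tau /\ trace tau = 1.

Lemma tau_prod_gram (Y : 'I_s -> finType) (G : forall k, A k -> Y k -> C) :
  tau_prod (fun k => mm (G k) (ad (G k))) =
  mm (fun (x : prodT A) (y : prodT Y) => \prod_k G k (x k) (y k))
     (ad (fun (x : prodT A) (y : prodT Y) => \prod_k G k (x k) (y k))).
Proof.
apply/funext => x; apply/funext => x'.
rewrite /tau_prod /mm -(big_dffun (fun k y => G k (x k) y * ad (G k) y (x' k))).
by apply: eq_bigr => y _; rewrite big_split /= /ad rmorph_prod.
Qed.

Lemma state_tau_prod tau : (forall k, state (tau k)) -> state (tau_prod tau).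
Proof.
move=> st; split; last first.
  rewrite /trace /tau_prod (big_dffun (fun k a => tau k a a)) big1 // => k _.
  by have [_] := st k.
have h k : {G : Mat R (A k) | tau k = mm G (ad G)}.
  by apply: cid; apply: psd_gram; case: (st k).
have -> : tau = (fun k => mm (sval (h k)) (ad (sval (h k)))).
  by apply: functional_extensionality_dep => k; exact: (svalP (h k)).
by rewrite tau_prod_gram; exact: psd_mm_ad.
Qed.

End ProductStates.

Section Transpose.
Variable R : realType.
Local Notation C := (R[i]).
Variables (s n : nat) (A : 'I_s -> finType).

Definition An (k : 'I_s) : finType := powT n (A k).
(** Regroups an input listed by sender into one listed by use, in agreement with the indexing of
    [tensor_pow]. *)
Definition coT (x : prodT An) (j : 'I_n) : prodT A := [ffun k => x k j].
Definition ev (I : finType) (z : powT n I) (j : 'I_n) : I := z j.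

Lemma coords_ev (I : finType) : coords (@ev I).
Proof. exact: coords_ffun. Qed.

Lemma coords_coT : coords coT.
Proof.
exists (fun z : {ffun 'I_n -> prodT A} => [ffun k => [ffun j => z j k]] : prodT An).
  by move=> x; apply/ffunP => k; apply/ffunP => j; rewrite !ffunE.
by move=> z; apply/ffunP => j; apply/ffunP => k; rewrite !ffunE.
Qed.

(** A one-site kernel factorizes over senders, so the reduced input of a single use is again a
    product and competes in the single-use supremum. *)
Lemma marg_tau_prod (tau : forall k, Mat R (An k)) i :
  marg coT (tau_prod tau) i = tau_prod (fun k => marg (@ev (A k)) (tau k) i).
Proof.
apply/funext => p; apply/funext => p'; rewrite /marg /tau_prod.
rewrite -(big_dffun2 (fun k a a' => tau k a a' *
  loc (@ev (A k)) i (fun b b' => (b == p k)%:R * (b' == p' k)%:R) a a')).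
apply: eq_bigr => x _; apply: eq_bigr => x' _.
rewrite big_split /=; congr (_ * _); rewrite /loc exchange_big /=.
apply: eq_bigr => j _; case: ifP => _; rewrite ?delta_dffun.
  rewrite -big_split /=; apply: eq_bigr => k _.
  by rewrite !ffunE.
by apply: eq_bigr => k _; rewrite !ffunE.
Qed.

Lemma tens_tau_prod (tau : forall k, Mat R (A k)) :
  tens coT coT (fun=> tau_prod tau) =
  tau_prod (fun k => tens (@ev (A k)) (@ev (A k)) (fun=> tau k)).
Proof.
apply/funext => x; apply/funext => x'; rewrite /tens /tau_prod exchange_big /=.
by apply: eq_bigr => k _; apply: eq_bigr => j _; rewrite !ffunE.
Qed.

End Transpose.

(** * Stinespring dilation of a channel *)

Section Kraus.
Variable R : realType.
Local Notation C := (R[i]).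

Lemma linear_map_sum (A B X : finType) (N : Mat R A -> Mat R B) :
  linear_map N -> forall (c : X -> C) (M : X -> Mat R A),
  N (fun a a' => \sum_x c x * M x a a') = fun b b' => \sum_x c x * N (M x) b b'.
Proof.
move=> lin c M.
pose zero (I : finType) : Mat R I := fun _ _ => 0.
have N0 : N (zero A) = zero B.
  have e : (fun a a' => -1 * zero A a a' + zero A a a') = zero A.
    by apply/funext => a; apply/funext => a'; rewrite /zero mulr0 addr0.
  rewrite -e lin; apply/funext => b; apply/funext => b'.
  by rewrite mulN1r addNr.
elim: (index_enum X) => [|x r IH].
  have -> : (fun a a' => \sum_(x <- [::]) c x * M x a a') = zero A.
    by apply/funext => a; apply/funext => a'; rewrite big_nil.
  by rewrite N0; apply/funext => b; apply/funext => b'; rewrite big_nil.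
have -> : (fun a a' => \sum_(z <- x :: r) c z * M z a a') =
    fun a a' => c x * M x a a' + \sum_(z <- r) c z * M z a a'.
  by apply/funext => a; apply/funext => a'; rewrite big_cons.
by rewrite lin IH; apply/funext => b; apply/funext => b'; rewrite big_cons.
Qed.

Lemma linear_map_units (A B : finType) (N : Mat R A -> Mat R B) X b b' :
  linear_map N ->
  N X b b' = \sum_p \sum_p' X p p' * N (matunit R p p') b b'.
Proof.
move=> lin.
have XE : X = fun a a' => \sum_(z : A * A) X z.1 z.2 * matunit R z.1 z.2 a a'.
  apply/funext => a; apply/funext => a'; rewrite sum_pair /=.
  rewrite -(sum_deltal a (fun p => X p a')); apply: eq_bigr => p _.
  rewrite -(sum_deltal a' (fun p' => X p p')) mulr_sumr; apply: eq_bigr => p' _.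
  by rewrite /matunit -mulnb natrM; ring.
by rewrite {1}XE linear_map_sum // sum_pair.
Qed.

Lemma trace_matunit (A : finType) (p p' : A) : trace (matunit R p p') = (p == p')%:R.
Proof.
rewrite /trace /matunit -(sum_deltal p (fun i => (i == p')%:R)).
by apply: eq_bigr => i _; rewrite -natrM mulnb eq_sym.
Qed.

(* The isometry is read off a factorization of the Choi matrix of [N]. *)
Lemma stinespring (A B : finType) (N : Mat R A -> Mat R B) : CPTP N ->
  exists (E : finType) (V : B * E -> A -> C),
    mm (ad V) V = @id_mat R A /\ forall X, N X = ptrace2 (stin V X).
Proof.
move=> [lin cp tp].
(* The unnormalized maximally entangled operator; its reference is an ordinal because
   [completely_positive] tests ordinals. *)
pose X0 : Mat R (A * 'I_#|A|)%type :=
  fun x y => (x.1 == enum_val x.2)%:R * (y.1 == enum_val y.2)%:R.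
have X0p : psd X0.
  pose G (x : A * 'I_#|A|) (z : 'I_1) : C := (x.1 == enum_val x.2)%:R.
  have -> : X0 = mm G (ad G); last exact: psd_mm_ad.
  apply/funext => x; apply/funext => y.
  by rewrite /mm big_ord1 /ad /G rmorph_nat.
have [G GE] := psd_gram (cp _ _ X0p).
(* The column index of the Gram factor of the Choi matrix serves as the environment. *)
pose V (be : B * (B * 'I_#|A|)) (p : A) : C := G (be.1, enum_rank p) be.2.
have NE p p' b b' : N (matunit R p p') b b' = \sum_e V (b, e) p * (V (b', e) p')^*.
  have := congr1 (fun f : Mat R (B * 'I_#|A|)%type =>
    f (b, enum_rank p) (b', enum_rank p')) GE.
  rewrite /tensor_id /= => h; rewrite [RHS](_ : _ = mm G (ad G) (b, enum_rank p) (b', enum_rank p')) //.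
  rewrite -h; congr (N _ b b'); apply/funext => a; apply/funext => a'.
  by rewrite /X0 /= !enum_rankK /matunit -mulnb natrM.
exists (B * 'I_#|A|)%type, V; split.
  (* The isometry property is trace preservation on matrix units. *)
  apply/funext => p; apply/funext => p'; rewrite /id_mat eq_sym -trace_matunit -tp.
  rewrite /trace /mm sum_pair; apply: eq_bigr => b _; rewrite NE.
  by apply: eq_bigr => e _; rewrite /ad mulrC.
move=> X; apply/funext => b; apply/funext => b'.
rewrite (linear_map_units X b b' lin) /ptrace2.
under [RHS]eq_bigr do rewrite stinE.
rewrite -[RHS]exchange_big3; apply: eq_bigr => p _; apply: eq_bigr => p' _.
by rewrite NE mulr_sumr.
Qed.

End Kraus.

(** * Capacity in terms of input states, and its additivity *)

Section Capacity.
Variable R : realType.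
Local Notation C := (R[i]).

Section SingleUse.
Variables (s : nat) (A : 'I_s -> finType) (B E : finType).
Variables (N : Mat R (prodT A) -> Mat R B) (V : B * E -> prodT A -> C).
Hypothesis NE : forall X, N X = ptrace2 (stin V X).

(** The vector with amplitudes [Om] lives on [B], [E] and the references. [entropy_dual] is applied
    to two of its cuts, references against [BE] and [E] against the rest. *)
Lemma CtildeEU_info (Aref : 'I_s -> finType) (psi : forall k, A k * Aref k -> C) :
  let G k (a : A k) (y : Aref k) := psi k (a, y) in
  CtildeEU N psi = channel_info V (tau_prod (fun k => mm (G k) (ad (G k)))).
Proof.
move=> G; rewrite /CtildeEU /channel_info /qmutinf tau_prod_gram.
set Psi : prodT A -> prodT Aref -> C := fun x y => \prod_k G k (x k) (y k).
pose Om := mm V Psi.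
have stinO : stin V (mm Psi (ad Psi)) = mm Om (ad Om).
  by rewrite /stin /Om ad_mm !mmA.
pose H (by_ : B * prodT Aref) (e : E) : C := Om (by_.1, e) by_.2.
have rhoE : tensor_id N (prod_pure psi) = mm H (ad H).
  apply/funext => -[b y]; apply/funext => -[b' y'].
  rewrite /tensor_id NE /ptrace2 /mm; apply: eq_bigr => e _ /=.
  rewrite /stin /mm /H /Om /ad /= /mm rmorph_sum mulr_sumr.
  apply: eq_bigr => x' _; rewrite !mulr_suml; apply: eq_bigr => x _.
  by rewrite rmorphM /= /Psi /prod_pure; ring.
rewrite rhoE (entropy_dual H) stinO (entropy_dual Om); congr (_ + _ - _).
- congr entropy; apply/funext => b; apply/funext => b'.
  by rewrite /ptrace2 /mm exchange_big.
- congr entropy; apply/funext => y; apply/funext => y'.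
  rewrite /ptrace1 sum_pair; apply: eq_bigr => b _.
  by apply: eq_bigr => e _.
congr entropy; apply/funext => e; apply/funext => e'.
by rewrite /ptrace1 sum_pair.
Qed.

(** Eliminates the references: a normalized vector gives a reduced state, and conversely a Gram
    factor of [tau k] is a purification whose reference has dimension [#|A k|]. *)
Lemma C1EU_states : C1EU N = ereal_sup [set x : \bar R |
  exists tau : forall k, Mat R (A k), (forall k, state (tau k)) /\
    x = (channel_info V (tau_prod tau))%:E].
Proof.
congr ereal_sup; apply/seteqP; split => x /=.
  move=> [d [psi [psi1 ->]]]; rewrite CtildeEU_info.
  eexists; split; last reflexivity.
  move=> k; split; first exact: psd_mm_ad.
  rewrite -(psi1 k) sum_pair; apply: eq_bigr => a _.
  by apply: eq_bigr => y _; rewrite /ad mulrC.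
move=> [tau [st ->]].
have h k : {G : Mat R (A k) | tau k = mm G (ad G)}.
  by apply: cid; apply: psd_gram; case: (st k).
exists (fun k => #|A k|).
pose psi k (x : A k * 'I_#|A k|) := sval (h k) x.1 (enum_val x.2).
have tauE : tau = fun k => mm (fun a y => psi k (a, y)) (ad (fun a y => psi k (a, y))).
  apply: functional_extensionality_dep => k; rewrite {1}(svalP (h k)).
  apply/funext => a; apply/funext => a'; rewrite /mm (reindex (@enum_val _ (A k))) //=.
  by exists enum_rank => z _; rewrite ?enum_valK ?enum_rankK.
exists psi; split; last by rewrite CtildeEU_info {1}tauE.
move=> k; have [_ t1] := st k.
have tr := congr1 (fun t : forall k, Mat R (A k) => trace (t k)) tauE.
rewrite /normalized sum_pair; apply: etrans t1; rewrite tr.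
by apply: eq_bigr => a _; apply: eq_bigr => y _; rewrite /ad mulrC.
Qed.

End SingleUse.

(** Tracing out the joint environment multiplies the single-use traces, by distributivity over
    environment tuples. *)
Lemma tensor_pow_stinespring (s : nat) (A : 'I_s -> finType) (B E : finType)
  (N : Mat R (prodT A) -> Mat R B) (V : B * E -> prodT A -> C) n X :
  (forall X, N X = ptrace2 (stin V X)) ->
  tensor_pow N n X = ptrace2 (stin (stin_pow (@ev n B) (@ev n E) (@coT s n A) V) X).
Proof.
move=> NE.
have NU p p' b b' : N (matunit R p p') b b' = \sum_e V (b, e) p * (V (b', e) p')^*.
  rewrite NE /ptrace2; apply: eq_bigr => e _; rewrite stinE.
  rewrite -(sum_deltal p (fun q => V (b, e) q * (V (b', e) p')^*)).
  apply: eq_bigr => q _; rewrite -(sum_deltal p' (fun q' => V (b, e) q * (V (b', e) q')^*)).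
  rewrite mulr_sumr; apply: eq_bigr => q' _.
  by rewrite /matunit -mulnb natrM (eq_sym p) (eq_sym p'); ring.
apply/funext => b; apply/funext => b'; rewrite /tensor_pow /ptrace2.
under [RHS]eq_bigr do rewrite stinE.
rewrite -[RHS]exchange_big3; apply: eq_bigr => x _; apply: eq_bigr => x' _.
rewrite -mulr_sumr; congr (_ * _).
under eq_bigr do rewrite NU.
rewrite -(big_coord (@coords_ev n E) (fun i e => V (b i, e) (coT x i) * (V (b' i, e) (coT x' i))^*)).
apply: eq_bigr => e _; rewrite big_split /=.
by rewrite /stin_pow /tens rmorph_prod.
Qed.

(** The normalized supremum is the same for every positive number of uses, by one inequality on
    reduced inputs and one on tensor powers. *)
Lemma C1EU_tensor_pow (s : nat) (A : 'I_s -> finType) (B : finType)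
  (N : Mat R (prodT A) -> Mat R B) n : CPTP N ->
  (C1EU (tensor_pow N n.+1) * ((n.+1)%:R^-1)%:E)%E = C1EU N.
Proof.
move=> /stinespring[E [V [Viso NE]]].
pose coB := @ev n.+1 B; pose coE := @ev n.+1 E; pose coQ := @coT s n.+1 A.
have coBP : coords coB by exact: coords_ev.
have coEP : coords coE by exact: coords_ev.
have coQP : coords coQ by exact: coords_coT.
rewrite (C1EU_states (fun X => tensor_pow_stinespring X NE)) (C1EU_states NE).
set Sn := [set x | _]; set S1 := [set x | _].
have n0 : (0 : R) < n.+1%:R by rewrite ltr0n.
apply/eqP; rewrite eq_le; apply/andP; split.
  rewrite lee_pdivrMr //; apply: ge_ereal_sup => _ [tau [st ->]].
  pose tau_ i k := marg (@ev n.+1 (A k)) (tau k) i.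
  have tau_st i k : state (tau_ i k).
    have [tp t1] := st k; split; first exact: (psd_marg (@coords_ev n.+1 (A k))).
    by rewrite (trace_marg (@coords_ev n.+1 (A k))).
  have [Tp T1] := state_tau_prod st.
  have := channel_info_le coBP coEP coQP Viso Tp T1.
  under eq_bigr do rewrite marg_tau_prod.
  rewrite -lee_fin => /le_trans; apply.
  have ub i : ((channel_info V (tau_prod (tau_ i)))%:E <= ereal_sup S1)%E.
    by apply: ereal_sup_ubound; exists (tau_ i).
  (* A finite supremum is summed over the uses, [+oo] is immediate, and [-oo] contradicts the bound
     at use 0, which exists because there are [n.+1] uses. *)
  move: ub; case: (ereal_sup S1) => [r| |] ub.
  - rewrite -EFinM lee_fin mulr_natr -[X in _ *+ X]card_ord -sumr_const.
    by apply: ler_sum => i _; rewrite -lee_fin; exact: ub.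
  - by rewrite gt0_mulye ?lte_fin ?leey.
  - by move: (ub ord0); rewrite leNgt ltNyr.
apply: ge_ereal_sup => _ [tau [st ->]].
rewrite lee_pdivlMr // -EFinM mulr_natr; apply: ereal_sup_ubound.
(* Each sender repeats its single-use state independently over the uses. *)
exists (fun k => tens (@ev n.+1 (A k)) (@ev n.+1 (A k)) (fun=> tau k)); split.
  move=> k; have [tp t1] := st k; split.
    have [G ->] := psd_gram tp.
    rewrite -(mm_tens (@ev n.+1 (A k)) (@ev n.+1 (A k)) (fun=> G) (fun=> ad G)
      (@coords_ev n.+1 (A k))).
    by rewrite -ad_tens; exact: psd_mm_ad.
  rewrite /trace /tens (big_coord (@coords_ev n.+1 (A k)) (fun _ a => tau k a a)).
  by rewrite big1 // => j _; exact: t1.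
have [Tp T1] := state_tau_prod st.
rewrite -tens_tau_prod; congr EFin; apply/esym.
exact: channel_info_tens.
Qed.

End Capacity.

(* C_{E,U}(N) = lim_n (1/n) C^{(1)}_{E,U}(N^{(x)n}) exists and equals C^{(1)}_{E,U}(N) *)
Theorem theorem1 (R : realType) (s : nat) (Ain : 'I_s -> finType) (B : finType)
  (N : Mat R (prodT Ain) -> Mat R B) :
  (0 < s)%N -> CPTP N ->
  (fun n : nat => (C1EU (tensor_pow N n.+1) * ((n.+1)%:R^-1)%:E)%E) @ \oo
    --> C1EU N.
Proof.
move=> _ Ncptp.
(* The sequence is constant. *)
under eq_fun do rewrite C1EU_tensor_pow //.
exact: cvg_cst.
Qed.
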